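(* Consider the following classes of closed subgroups of $S_\infty$: (a) the compact (equivalently, profinite) groups; (b) the locally compact groups; (c) the Roelcke precompact groups; (d) the oligomorphic groups. For each of the classes (a), (b), (c), the relation of topological group isomorphism on the class is Borel bireducible with the isomorphism relation on countable graphs (that is, each is Borel reducible to the other). For the class (d), the relation of topological group isomorphism on the class is Borel reducible to the isomorphism relation on countable graphs.
   Context: $S_\infty$ is the Polish group of all permutations of $\omega$ with the topology of pointwise convergence. For a Polish space $X$, $\mathcal F(X)$ is the set of closed subsets of $X$, with the Effros Borel structure: the $\sigma$-algebra generated by the sets $\{D\in\mathcal F(X)\colon D\cap U\neq\emptyset\}$ for $U\subseteq X$ open. The closed subgroups of $S_\infty$ form a Borel subset of $\mathcal F(S_\infty)$, hence a standard Borel space, and each of the classes (a)-(d) is a Borel subset of it. A closed subgroup $G$ of $S_\infty$ is oligomorphic if for each $n$ the natural action of $G$ on $\omega^n$ has only finitely many orbits. A topological group $G$ is Roelcke precompact if for each neighbourhood $U$ of $1$ there is a finite set $F\subseteq G$ such that $UFU=G$. Countable graphs are symmetric irreflexive graphs with domain $\omega$, forming a Polish space (a closed subset of $\mathcal P(\omega\times\omega)$). For equivalence relations $E,F$ on standard Borel spaces $X,Y$, $E$ is Borel reducible to $F$ if there is a Borel function $f\colon X\to Y$ such that $xEx' \Leftrightarrow f(x)Ff(x')$ for all $x,x'\in X$. *)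

(* Defs.v *)
From HB Require Import structures.
From mathcomp Require Import all_boot all_order all_algebra.
From mathcomp Require Import all_classical all_reals all_analysis.

Set Implicit Arguments.
Unset Strict Implicit.
Unset Printing Implicit Defensive.

Local Open Scope classical_set_scope.

HB.mixin Record isTopologicalGroup G & Topological G & Group G := {
  mulg_continuous : continuous (fun xy : G * G => (xy.1 * xy.2)%g);
  invg_continuous : continuous (fun x : G => x^-1%g)
}.

#[short(type="topGroupType")]
HB.structure Definition TopologicalGroup :=
  {G of Topological G & Group G & isTopologicalGroup G}.

Definition topgroup_isom (G H : topGroupType) : Prop :=
  exists (f : G -> H) (g : H -> G),
    [/\ cancel f g, cancel g f, {morph f : x y / (x * y)%g},
        continuous f & continuous g].

Definition prodset (G : magmaType) (A B : set G) : set G :=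
  [set (x * y)%g | x in A & y in B].

Definition roelcke_precompact (G : topGroupType) : Prop :=
  forall U : set G, nbhs 1%g U ->
    exists2 F : set G, finite_set F & prodset (prodset U F) U = [set: G].

(* [set_type] carries the subspace topology, here that of pointwise convergence
   of functions from the discrete space nat to itself. *)
Definition Sinf : Type := [set f : {ptws nat -> nat} | bijective f].

HB.instance Definition _ := Topological.on Sinf.

Definition perm_fun (p : Sinf) : nat -> nat := \val p.
Coercion perm_fun : Sinf >-> Funclass.

Definition mkSinf (f : nat -> nat) (bij_f : bijective f) : Sinf :=
  SigSub (mem_set bij_f : f \in [set f : {ptws nat -> nat} | bijective f]).

Lemma SinfP (p q : Sinf) : p =1 q -> p = q.
Proof. by move=> pq; apply/val_inj/funext. Qed.

Lemma Sinf_bij (p : Sinf) : bijective p.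
Proof. exact: (set_mem (valP p)). Qed.

Lemma Sinf_inv (p : Sinf) :
  {q : nat -> nat | cancel p q /\ cancel q p}.
Proof. by apply: cid; case: (Sinf_bij p) => q pq qp; exists q. Qed.

Lemma Sinf_inv_bij (p : Sinf) : bijective (sval (Sinf_inv p)).
Proof. by case: (Sinf_inv p) => q [pq qp]; exists p. Qed.

Definition Sinf_one : Sinf := mkSinf (inv_bij (fun n : nat => erefl (id (id n)))).
Definition Sinf_mul (p q : Sinf) : Sinf :=
  mkSinf (bij_comp (Sinf_bij p) (Sinf_bij q)).
Definition Sinf_invg (p : Sinf) : Sinf := mkSinf (Sinf_inv_bij p).

Lemma Sinf_mulA : associative Sinf_mul.
Proof. by move=> p q r; apply: SinfP. Qed.

Lemma Sinf_mul1 : left_id Sinf_one Sinf_mul.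
Proof. by move=> p; apply: SinfP. Qed.

Lemma Sinf_mulr1 : right_id Sinf_one Sinf_mul.
Proof. by move=> p; apply: SinfP. Qed.

Lemma Sinf_mulV : left_inverse Sinf_one Sinf_invg Sinf_mul.
Proof. by move=> p; apply: SinfP; exact: (svalP (Sinf_inv p)).1. Qed.

Lemma Sinf_mulrV : right_inverse Sinf_one Sinf_invg Sinf_mul.
Proof. by move=> p; apply: SinfP; exact: (svalP (Sinf_inv p)).2. Qed.

HB.instance Definition _ := isGroup.Build Sinf
  Sinf_mulA Sinf_mul1 Sinf_mulr1 Sinf_mulV Sinf_mulrV.

Lemma SinfME (p q : Sinf) n : ((p * q)%g : Sinf) n = p (q n).
Proof. by []. Qed.

Lemma SinfVK (p : Sinf) : cancel p ((p^-1)%g : Sinf).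
Proof. exact: (svalP (Sinf_inv p)).1. Qed.

Lemma SinfKV (p : Sinf) : cancel ((p^-1)%g : Sinf) p.
Proof. exact: (svalP (Sinf_inv p)).2. Qed.

Lemma nbhs_Sinf_pt (p : Sinf) n : nbhs p [set q : Sinf | q n = p n].
Proof.
have c : {for p, continuous
    (fun q : Sinf => @proj nat (fun=> nat) n (\val q))}.
  apply: continuous_comp; last exact: proj_continuous.
  exact: (@initial_continuous Sinf {ptws nat -> nat}).
by have := c [set p n]; apply; exact: discrete_set1.
Qed.

Lemma cvg_Sinf (T : Type) (F : set_system T) (f : T -> Sinf) (p : Sinf) :
  Filter F -> (forall n, \forall t \near F, f t n = p n) -> f @ F --> p.
Proof.
move=> FF Fp.
have fp : (fun t => \val (f t)) @ F --> (\val p : {ptws nat -> nat}).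
  apply/pointwise_cvgP => n A /= /nbhs_singleton Apn.
  by apply: filterS (Fp n) => t /= ftn; rewrite -[_ n]/(f t n) ftn.
move=> A [B [[C oC <-] Cp] CA].
have /fp : nbhs (\val p : {ptws nat -> nat}) C by exact: open_nbhs_nbhs.
by move=> FC; apply: (@filterS _ F FF ((fun t => \val (f t)) @^-1` C)) => // t;
  exact: CA.
Qed.

Lemma Sinf_mulg_continuous :
  continuous (fun pq : Sinf * Sinf => (pq.1 * pq.2)%g).
Proof.
move=> [p q]; apply: cvg_Sinf => n.
exists ([set p' : Sinf | p' ((q : Sinf) n) = (p : Sinf) ((q : Sinf) n)],
        [set q' : Sinf | q' n = (q : Sinf) n]).
  by split => /=; exact: nbhs_Sinf_pt.
by move=> [p' q'] [/= p'E q'E]; rewrite !SinfME q'E p'E.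
Qed.

Lemma Sinf_invg_continuous : continuous (fun p : Sinf => (p^-1)%g).
Proof.
move=> p; apply: (cvg_Sinf (nbhs_filter p)) => n.
apply: (@filterS _ _ (nbhs_filter p)) (@nbhs_Sinf_pt p (((p^-1)%g : Sinf) n)).
by move=> q /=; rewrite SinfKV => qE; rewrite -[n in LHS]qE SinfVK.
Qed.

HB.instance Definition _ := isTopologicalGroup.Build Sinf
  Sinf_mulg_continuous Sinf_invg_continuous.

Definition closed_set (X : topologicalType) : Type := [set D : set X | closed D].

HB.instance Definition _ (X : topologicalType) := Choice.on (closed_set X).
HB.instance Definition _ (X : topologicalType) :=
  isPointed.Build (closed_set X) (SigSub (mem_set (@closed0 X))).

Definition hits (X : topologicalType) (U : set X) : set (closed_set X) :=
  [set D : closed_set X | \val D `&` U !=set0].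

(* The Effros Borel structure on the closed subsets of X. *)
Definition effros (X : topologicalType) : Type :=
  g_sigma_algebraType [set hits U | U in @open X].

HB.instance Definition _ (X : topologicalType) := Measurable.on (effros X).

Definition subgroups : set (effros Sinf) :=
  [set D : effros Sinf | group_closed (mem (\val (D : closed_set Sinf)))].

Definition closed_subgroup : Type := subgroups.

HB.instance Definition _ := Choice.on closed_subgroup.

Definition cset (G : closed_subgroup) : set Sinf :=
  \val (\val G : closed_set Sinf).
Lemma cset_closed (G : closed_subgroup) : closed (cset G).
Proof. exact: (set_mem (valP (\val G))). Qed.
Lemma cset_group (G : closed_subgroup) : group_closed (mem (cset G)).
Proof. exact: (set_mem (valP G)). Qed.

Definition group_of (G : closed_subgroup) : Type := cset G.
Coercion group_of : closed_subgroup >-> Sortclass.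

Section group_of.
Variable G : closed_subgroup.

HB.instance Definition _ := SubChoice.on (group_of G).
HB.instance Definition _ := Topological.on (group_of G).
HB.instance Definition _ := SubChoice_isSubGroup.Build Sinf (mem (cset G))
  (group_of G) (cset_group G).

End group_of.

Section group_of_topology.
Variable G : closed_subgroup.

Lemma group_of_continuous (T : topologicalType) (f : T -> G) :
  continuous (fun t => \val (f t) : Sinf) -> continuous f.
Proof.
move=> cf; apply: (@continuous_comp_initial _ _ _ (@set_val _ (cset G))).
exact: cf.
Qed.

Lemma group_of_val_continuous : continuous (fun x : G => \val x : Sinf).
Proof. exact: initial_continuous. Qed.

Lemma group_of_mulg_continuous :
  continuous (fun xy : G * G => (xy.1 * xy.2)%g).
Proof.
apply: group_of_continuous => -[x y].
have -> : (fun t : G * G => \val (t.1 * t.2)%g : Sinf) =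
    (fun pq : Sinf * Sinf => (pq.1 * pq.2)%g) \o
    (fun t : G * G => (\val t.1 : Sinf, \val t.2 : Sinf)).
  by apply/funext => t.
apply: continuous_comp; last exact: mulg_continuous.
apply: (@cvg_pair _ _ _ _ (nbhs (\val x : Sinf)) (nbhs (\val y : Sinf))).
  by apply: continuous_comp; [exact: cvg_fst|exact: group_of_val_continuous].
by apply: continuous_comp; [exact: cvg_snd|exact: group_of_val_continuous].
Qed.

Lemma group_of_invg_continuous : continuous (fun x : G => x^-1%g).
Proof.
apply: group_of_continuous => x.
have -> : (fun t : G => \val (t^-1)%g : Sinf) =
    (fun p : Sinf => (p^-1)%g) \o (fun t : G => \val t : Sinf).
  by apply/funext => t.
apply: continuous_comp; first exact: group_of_val_continuous.
exact: invg_continuous.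
Qed.

HB.instance Definition _ := isTopologicalGroup.Build (group_of G)
  group_of_mulg_continuous group_of_invg_continuous.

End group_of_topology.

Lemma subgroupsT : subgroups (SigSub (mem_set closedT) : closed_set Sinf).
Proof. by split=> [|x y _ _]; exact: in_setT. Qed.

HB.instance Definition _ :=
  isPointed.Build closed_subgroup (SigSub (mem_set subgroupsT)).

HB.instance Definition _ := Measurable.copy closed_subgroup
  (g_sigma_algebra_preimageType
     (fun G : closed_subgroup => \val G : effros Sinf)).

(* The sigma-algebra induced on A, its members being viewed as subsets of X. *)
Definition relatively_measurable d (X : measurableType d) (A : set X) :
  set (set X) := [set A `&` B | B in measurable].

(* E is considered on A and F on B. The Borel map from A to B is the restriction
   to A of f, whose values outside A are irrelevant. [measurable_fun A f] is not
   used because it holds vacuously when A is not measurable. *)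
Definition borel_reducible d d' (X : measurableType d) (Y : measurableType d')
    (A : set X) (E : X -> X -> Prop) (B : set Y) (F : Y -> Y -> Prop) : Prop :=
  exists f : X -> Y,
    [/\ set_fun A B f,
        forall V, measurable V -> relatively_measurable A (A `&` f @^-1` V) &
        forall x x', A x -> A x' -> (E x x' <-> F (f x) (f x'))].

Definition borel_bireducible d d' (X : measurableType d) (Y : measurableType d')
    (A : set X) (E : X -> X -> Prop) (B : set Y) (F : Y -> Y -> Prop) : Prop :=
  borel_reducible A E B F /\ borel_reducible B F A E.

(* P(omega x omega) is identified with 2^(omega x omega), with the product
   topology. *)
Definition graph_set : set {ptws nat * nat -> bool} :=
  [set e : {ptws nat * nat -> bool} |
    (forall x y, e (x, y) = e (y, x)) /\ (forall x, e (x, x) = false)].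

Definition graph : Type := graph_set.

HB.instance Definition _ := Topological.on graph.

Definition adj (e : graph) (x y : nat) : bool := \val e (x, y).

Lemma empty_graph_subproof : graph_set (fun=> false).
Proof. by []. Qed.

HB.instance Definition _ :=
  isPointed.Build graph (SigSub (mem_set empty_graph_subproof)).

HB.instance Definition _ := Measurable.copy graph
  (g_sigma_algebraType (@open graph)).

Definition graph_isom (e e' : graph) : Prop :=
  exists2 p : nat -> nat, bijective p &
    forall x y, adj e x y = adj e' (p x) (p y).

Definition group_isom (G H : closed_subgroup) : Prop := topgroup_isom G H.

Definition compact_groups : set closed_subgroup :=
  [set G : closed_subgroup | compact [set: G]].
Definition locally_compact_groups : set closed_subgroup :=
  [set G : closed_subgroup | locally_compact [set: G]].
Definition roelcke_precompact_groups : set closed_subgroup :=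
  [set G : closed_subgroup | roelcke_precompact G].

Definition tuple_orbit (G : closed_subgroup) n (t : n.-tuple nat) :
    set (n.-tuple nat) :=
  [set map_tuple (\val g : Sinf) t | g in [set: G]].

Definition oligomorphic (G : closed_subgroup) : Prop :=
  forall n, finite_set [set tuple_orbit G t | t in [set: n.-tuple nat]].

Definition oligomorphic_groups : set closed_subgroup :=
  [set G : closed_subgroup | oligomorphic G].

(* Main.v *)
Require Import Defs.
From HB Require Import structures.
From mathcomp Require Import all_boot all_order all_algebra.
From mathcomp Require Import all_classical all_reals all_analysis.

Set Implicit Arguments.
Unset Strict Implicit.
Unset Printing Implicit Defensive.

Import GRing.Theory.
Local Open Scope classical_set_scope.

(** Upper and lower bounds each come from a single construction.

    Upper bound. In a topological group G, consider the open cosets A, the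
    nonempty open sets with A A^-1 A included in A, that satisfy the Roelcke
    covering condition: for each neighbourhood N of 1, A is covered by N F N for
    a finite F ([rpcoset]). Open subcosets and translates of such a coset are
    again such cosets. As soon as there is one, they contain a base at 1, and
    this is so in each of the four classes: for a Roelcke precompact G, in
    particular a compact or oligomorphic one, the whole group is one, and in the
    locally compact case small open subgroups lie in a compact set. The
    isomorphism invariant is the set of these cosets with the ternary relation
    A B <= C ([prod_sub]). It determines G: a bijection pi of the
    set of cosets such that A B <= C implies pi(A) B <= pi(C), and likewise for
    its inverse, is a left translation ([equivariant_translation]), because the
    cosets pi(stab k) shrink to a permutation, which is in G since G is closed.
    Thus G is the group of these bijections, and an isomorphism theta of the
    structures of G and H turns the translations of G into those of H
    ([coset_iso_topgroup_isom]).

    By the covering condition such a coset is a finite union of double cosets of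
    the stabilizer of 0, ..., k-1, and so has a finite name ([rpcoset_den]). All
    relations between named sets are Borel in G, since they amount to countable
    Boolean combinations of conditions saying that G, or its cube, meets an open
    set ([borel_den3]). The ternary structure is coded in a graph by attaching, to
    each triple in the relation, a path with four vertices whose last three
    vertices are joined to the members of the triple; each vertex is replaced by
    the infinite set of its names, a clique if the vertex is a coset and an
    independent set otherwise. The graph isomorphisms recover the
    ternary structure ([ternary_iso_blowup], [blowup_ternary_iso]).

    Lower bound. To a graph A is attached the group of all pairs (eps, c) with
    eps : nat -> bool and c a family of residues modulo 15, where 3 c = 0 at
    a vertex u, 5 c = 0 at an ordered pair of adjacent vertices, and c = 0 at the
    other pairs. It acts on countably many copies of Z/15 by x |-> +-x + c,
    the sign being that of eps u at u and the product of those of eps u and eps v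
    at (u, v). It is thus a product of copies of Z/3, one for each vertex, and of Z/5, one for
    each ordered pair of adjacent vertices, extended by a power of Z/2.
    It is compact as a continuous image of a product of finite sets. The elements
    of order 3 that each group element centralizes or inverts are exactly those
    supported on one vertex u, and such an element has centralizer eps u = 0. The
    vertices u and v are adjacent exactly when some nontrivial r with r^5 = 1 is
    centralized by exactly the elements with eps u = eps v ([adjacent_eltsP]). Hence
    even the abstract group determines the graph. *)

(** * Cosets satisfying the Roelcke covering condition *)

Section translations.
Variable G : topGroupType.
Implicit Types (x y : G) (A B N : set G).

Definition ltrans x A : set G := [set y | A (x^-1 * y)%g].
Definition rtrans A x : set G := [set y | A (y * x^-1)%g].

Lemma ltransM x y A : ltrans x (ltrans y A) = ltrans (x * y)%g A.
Proof. by apply/seteqP; split=> z; rewrite /ltrans/= invgM mulgA. Qed.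

Lemma ltrans1 A : ltrans 1%g A = A.
Proof. by apply/seteqP; split=> z; rewrite /ltrans/= invg1 mul1g. Qed.

Lemma mulg_continuousl x : continuous (fun y : G => x * y)%g.
Proof.
move=> y; apply: (@continuous_comp _ _ _ (fun y : G => (x, y))
  (fun p : G * G => p.1 * p.2)%g); last exact: mulg_continuous.
by apply: (@cvg_pair _ _ _ _ (nbhs x) (nbhs y)); [exact: cvg_cst|exact: cvg_id].
Qed.

Lemma mulg_continuousr x : continuous (fun y : G => y * x)%g.
Proof.
move=> y; apply: (@continuous_comp _ _ _ (fun y : G => (y, x))
  (fun p : G * G => p.1 * p.2)%g); last exact: mulg_continuous.
by apply: (@cvg_pair _ _ _ _ (nbhs y) (nbhs x)); [exact: cvg_id|exact: cvg_cst].
Qed.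

Lemma open_ltrans x A : open A -> open (ltrans x A).
Proof. by move: (@mulg_continuousl (x^-1)%g) => /continuousP; apply. Qed.

Lemma open_rtrans x A : open A -> open (rtrans A x).
Proof. by move: (@mulg_continuousr (x^-1)%g) => /continuousP; apply. Qed.

Lemma nbhs_conj x N : nbhs 1%g N -> nbhs 1%g [set y | N (x * y * x^-1)%g].
Proof.
move=> N1; have : nbhs (x * 1 * x^-1)%g N by rewrite mulg1 mulgV.
move=> /(@mulg_continuousr (x^-1)%g (x * 1)%g N).
exact: (@mulg_continuousl x 1%g).
Qed.

(** The sets with this ternary closure property are the left cosets of
    subgroups, equivalently the right cosets. *)
Definition coset_set A : Prop :=
  A !=set0 /\ forall x y z, A x -> A y -> A z -> A (x * y^-1 * z)%g.

(** For A the whole group this is Roelcke precompactness. Since F ranges over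
    subsets of the group and not of A, the condition passes to all subsets. *)
Definition rcovered A : Prop :=
  forall N, nbhs 1%g N ->
    exists2 F : set G, finite_set F & A `<=` prodset (prodset N F) N.

Definition rpcoset A : Prop := [/\ open A, coset_set A & rcovered A].

Lemma rcoveredS A B : A `<=` B -> rcovered B -> rcovered A.
Proof.
move=> AB cB N N1; have [F fF BF] := cB N N1.
by exists F => // x /AB /BF.
Qed.

(** If A is covered by N' F N' then x A is covered by (x N' x^-1) x F N'. *)
Lemma rcovered_ltrans x A : rcovered A -> rcovered (ltrans x A).
Proof.
move=> cA N N1.
have N1' := [elaborate filterI N1 (nbhs_conj x N1)].
have [F fF AF] := cA _ N1'.
exists ((fun y => x * y)%g @` F); first exact: finite_image.
move=> y /AF[_ [n [Nn Nxn] [f Ff <-]] [m [Nm _] nfm]].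
exists (x * n * x^-1 * (x * f))%g.
  by exists (x * n * x^-1)%g => //; exists (x * f)%g => //; exists f.
by exists m => //; rewrite -(mulVKg x y) -nfm !mulgA mulgVK.
Qed.

Lemma rcovered_rtrans x A : rcovered A -> rcovered (rtrans A x).
Proof.
move=> cA N N1.
have N1' := [elaborate filterI N1 (nbhs_conj x^-1%g N1)].
have [F fF AF] := cA _ N1'.
exists ((fun y => y * x)%g @` F); first exact: finite_image.
move=> y /AF[_ [n [Nn _] [f Ff <-]] [m [Nm Nxm] nfm]].
exists (n * (f * x))%g; first by exists n => //; exists (f * x)%g => //; exists f.
exists (x^-1 * m * x)%g; first by move: Nxm; rewrite /= invgK.
by rewrite -(mulgVK x y) -nfm !mulgA mulgK.
Qed.

Lemma coset_set_ltrans x A : coset_set A -> coset_set (ltrans x A).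
Proof.
move=> [[a Aa] cA]; split; first by exists (x * a)%g; rewrite /ltrans/= mulKg.
move=> u v w Au Av Aw; rewrite /ltrans/=.
by have := cA _ _ _ Au Av Aw; rewrite invgM invgK !mulgA mulgK.
Qed.

Lemma coset_set_rtrans x A : coset_set A -> coset_set (rtrans A x).
Proof.
move=> [[a Aa] cA]; split; first by exists (a * x)%g; rewrite /rtrans/= mulgK.
move=> u v w Au Av Aw; rewrite /rtrans/=.
by have := cA _ _ _ Au Av Aw; rewrite invgM invgK !mulgA mulgVK.
Qed.

Lemma rpcoset_ltrans x A : rpcoset A -> rpcoset (ltrans x A).
Proof.
by move=> [oA sA cA]; split; [exact: open_ltrans|exact: coset_set_ltrans|
  exact: rcovered_ltrans].
Qed.

Lemma rpcoset_rtrans x A : rpcoset A -> rpcoset (rtrans A x).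
Proof.
by move=> [oA sA cA]; split; [exact: open_rtrans|exact: coset_set_rtrans|
  exact: rcovered_rtrans].
Qed.

End translations.

(** * Closed subgroups of the permutation group *)

Definition agree k (f g : nat -> nat) : Prop := forall i, (i < k)%N -> f i = g i.

Lemma nbhs_agree (p : Sinf) k : nbhs p [set q : Sinf | agree k q p].
Proof.
elim: k => [|k IH]; first by apply: filterS filterT.
apply: filterS (filterI IH (nbhs_Sinf_pt p k)) => q [qk qE] i.
by rewrite ltnS leq_eqVlt => /orP[/eqP->//|/qk].
Qed.

(** The sets of permutations agreeing with p below k generate a filter that
    converges pointwise to p, so they are cofinal in the neighbourhoods of p. *)
Lemma Sinf_nbhs_base (p : Sinf) (N : set Sinf) : nbhs p N ->
  exists k, [set q : Sinf | agree k q p] `<=` N.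
Proof.
pose F : set_system Sinf :=
  filter_from [set: nat] (fun k => [set q : Sinf | agree k q p]).
have FF : Filter F.
  apply: filter_from_filter; first by exists 0%N.
  move=> i j _ _; exists (maxn i j) => // q qp.
  by split=> l lt; apply: qp; rewrite leq_max lt ?orbT.
have Fp : id @ F --> p.
  apply: cvg_Sinf => n; exists n.+1 => // q qp; exact: qp.
by move=> /Fp[k _ kN]; exists k.
Qed.

Section closed_subgroup_topology.
Variable G : closed_subgroup.

Definition pfun (g : G) : nat -> nat := (\val g : Sinf).

Lemma pfunM (g h : G) i : pfun (g * h)%g i = pfun g (pfun h i).
Proof. by []. Qed.

Lemma pfunK (g : G) : cancel (pfun g) (pfun g^-1%g).
Proof. exact: SinfVK. Qed.

Lemma pfunKV (g : G) : cancel (pfun g^-1%g) (pfun g).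
Proof. exact: SinfKV. Qed.

Lemma pfun_inj (g : G) : injective (pfun g).
Proof. exact: can_inj (pfunK g). Qed.

Lemma group_of_nbhs_base (g : G) (N : set G) :
  nbhs g N <-> exists k, [set h : G | agree k (pfun h) (pfun g)] `<=` N.
Proof.
split=> [[B [[C oC <-] Cg] CN]|[k kN]].
  have /Sinf_nbhs_base[k kC] : nbhs (\val g : Sinf) C by exact: open_nbhs_nbhs.
  by exists k => h hg; apply: CN; exact: kC.
apply: filterS kN _; exact: (group_of_val_continuous (nbhs_agree _ k)).
Qed.

Definition stab k : set G := [set g | forall i, (i < k)%N -> pfun g i = i].

Lemma stab_base (N : set G) : nbhs 1%g N <-> exists k, stab k `<=` N.
Proof. exact: group_of_nbhs_base. Qed.

Lemma stab1 k : stab k 1%g.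
Proof. by []. Qed.

Lemma stabM k x y : stab k x -> stab k y -> stab k (x * y)%g.
Proof. by move=> xk yk i ik; rewrite pfunM yk// xk. Qed.

Lemma stabV k x : stab k x -> stab k x^-1%g.
Proof. by move=> xk i ik; rewrite -{1}(xk i ik) pfunK. Qed.

Lemma stabS j k : (j <= k)%N -> stab k `<=` stab j.
Proof. by move=> jk x xk i ij; apply: xk; exact: leq_trans jk. Qed.

Lemma stab_coset k x y : stab k (x^-1 * y)%g <-> agree k (pfun y) (pfun x).
Proof.
split=> [xy i ik|xy i ik].
  by rewrite -{2}(xy i ik) pfunM pfunKV.
by rewrite pfunM xy// pfunK.
Qed.

Lemma open_stab k : open (stab k).
Proof.
rewrite openE => x xk; apply/group_of_nbhs_base; exists k => y yx i ik.
by rewrite yx// xk.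
Qed.

(** A translate of A contains 1, hence some stabilizer, and the covering
    condition is hereditary. *)
Lemma rpcoset_stab (A : set G) : rpcoset A ->
  exists k, forall j, (k <= j)%N -> rpcoset (stab j).
Proof.
move=> rA; have [_ [[a Aa] _] _] := rA.
have rB := rpcoset_ltrans a^-1%g rA.
have [oB cB rB'] := rB.
have /stab_base[k kB] : nbhs 1%g (ltrans a^-1%g A).
  by apply: open_nbhs_nbhs; split=> //; rewrite /ltrans/= invgK mulg1.
exists k => j kj; split; first exact: open_stab.
  split; first by exists 1%g.
  by move=> x y z xj yj zj; apply: stabM => //; apply: stabM => //; apply: stabV.
by apply: rcoveredS rB'; apply: subset_trans kB; exact: stabS.
Qed.

End closed_subgroup_topology.

(** * Left translations of the structure of cosets *)

Definition rpcosets (G : topGroupType) : set (set G) := [set A | rpcoset A].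

(** Left translations have this property: A B <= C implies x A B <= x C. *)
Definition equivariant (G : topGroupType) (pi : set G -> set G) : Prop :=
  set_fun (@rpcosets G) (@rpcosets G) pi /\
  forall A B C, rpcoset A -> rpcoset B -> rpcoset C ->
    prodset A B `<=` C -> prodset (pi A) B `<=` pi C.

Section equivariant.
Variables (G : topGroupType) (pi pi' : set G -> set G).
Hypothesis piE : equivariant pi.
Hypothesis piE' : equivariant pi'.
Hypothesis piK : forall A, rpcoset A -> pi' (pi A) = A.

(** With V = b^-1 pi(A), the inclusion pi(A) V <= pi(A) pulls back along pi' to
    A V <= A. *)
Lemma equivariant_shift A b y : rpcoset A -> rpcoset (pi A) ->
  pi A b -> pi A y -> forall a, A a -> A (a * (b^-1 * y))%g.
Proof.
move=> rA rpA pAb pAy a Aa.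
have [_ [_ cA] _] := rpA.
have /(piE'.2 _ _ _ rpA (rpcoset_ltrans b^-1%g rpA) rpA) :
    prodset (pi A) (ltrans b^-1%g (pi A)) `<=` pi A.
  move=> _ [u Au [v Av <-]]; move: Av; rewrite /ltrans/= invgK => Av.
  by have := cA _ _ _ Au pAb Av; rewrite !mulgA mulgVK.
rewrite piK//; apply; exists a => //; exists (b^-1 * y)%g => //.
by rewrite /ltrans/= invgK mulVKg.
Qed.

Lemma equivariant_shiftV A a y : rpcoset A -> A a -> A y ->
  forall b, pi A b -> pi A (b * (a^-1 * y))%g.
Proof.
move=> rA Aa Ay b Ab; have [_ [_ cA] _] := rA.
have /(piE.2 _ _ _ rA (rpcoset_ltrans a^-1%g rA) rA) :
    prodset A (ltrans a^-1%g A) `<=` A.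
  move=> _ [u Au [v Av <-]]; move: Av; rewrite /ltrans/= invgK => Av.
  by have := cA _ _ _ Au Aa Av; rewrite !mulgA mulgVK.
apply; exists b => //; exists (a^-1 * y)%g => //.
by rewrite /ltrans/= invgK mulVKg.
Qed.

(** So A and pi(A) are left cosets of the same subgroup. *)
Lemma equivariantP A a b y : rpcoset A -> A a -> pi A b ->
  pi A y <-> A (a * (b^-1 * y))%g.
Proof.
move=> rA Aa Ab; split=> [Ay|Ay].
  by apply: (equivariant_shift (b := b) rA) => //; exact: piE.1.
have := equivariant_shiftV rA Aa Ay Ab.
by rewrite mulKg mulVKg.
Qed.

(** Inclusion is definable from the product relation: A <= B if and only if
    A V <= B for some subgroup V. *)
Lemma equivariantS A B : rpcoset A -> rpcoset B -> A `<=` B -> pi A `<=` pi B.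
Proof.
move=> rA rB AB b Ab; have [_ [[a Aa] cA] _] := rA.
have /(piE.2 _ _ _ rA (rpcoset_ltrans a^-1%g rA) rB) :
    prodset A (ltrans a^-1%g A) `<=` B.
  move=> _ [u Au [v Av <-]]; move: Av; rewrite /ltrans/= invgK => Av.
  by have := cA _ _ _ Au Aa Av; rewrite !mulgA mulgVK => /AB.
apply; exists b => //; exists 1%g; last by rewrite mulg1.
by rewrite /ltrans/= invgK mulg1.
Qed.

(** With V = b^-1 B, the inclusion B (V h) <= B h shows that pi(B) h is included
    in pi(B h); the other inclusion follows by translating by the inverse. *)
Lemma equivariant_rtrans A g : rpcoset A -> pi (rtrans A g) = rtrans (pi A) g.
Proof.
have sub B h : rpcoset B -> rtrans (pi B) h `<=` pi (rtrans B h).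
  move=> rB y; rewrite /rtrans/= => By; have [_ [[b Bb] cB] _] := rB.
  have rB' := rpcoset_rtrans h (rpcoset_ltrans b^-1%g rB).
  have /(piE.2 _ _ _ rB rB' (rpcoset_rtrans h rB)) :
      prodset B (rtrans (ltrans b^-1%g B) h) `<=` rtrans B h.
    move=> _ [u Bu [v Bv <-]]; move: Bv; rewrite /rtrans/ltrans/= invgK => Bv.
    by have := cB _ _ _ Bu Bb Bv; rewrite !mulgA mulgVK.
  apply; exists (y * h^-1)%g => //; exists h; last by rewrite mulgVK.
  by rewrite /rtrans/ltrans/= invgK mulgV mulg1.
move=> rA; apply/seteqP; split; last exact: sub.
move=> y pAy; have := @sub _ g^-1%g (rpcoset_rtrans g rA) (y * g^-1)%g.
have -> : rtrans (rtrans A g) g^-1%g = A.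
  by apply/seteqP; split=> z; rewrite /rtrans/= invgK mulgK.
by apply; rewrite /rtrans/= invgK mulgVK.
Qed.

End equivariant.

Section translation.
Variables (G : closed_subgroup) (pi pi' : set G -> set G).
Hypothesis piE : equivariant pi.
Hypothesis piE' : equivariant pi'.
Hypothesis piK : forall A, rpcoset A -> pi' (pi A) = A.
Hypothesis piK' : forall A, rpcoset A -> pi (pi' A) = A.


Lemma equivariant_stab k b y : rpcoset (@stab G k) -> pi (@stab G k) b ->
  pi (stab k) y <-> agree k (pfun y) (pfun b).
Proof.
move=> rk kb; have E := equivariantP piE piE' piK y rk (@stab1 G k) kb; rewrite mul1g in E.
apply: iff_trans E _.
exact: stab_coset.
Qed.

(** Pick x_j in pi(stab j). Then x_j and x_i agree below i for i <= j, so the x_j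
    converge pointwise to an injection f. It is onto because pi is: if
    pi(a (stab n)) = stab n then x_j a lies in stab n for large j, that is, x_j
    maps a i to i for i < n. *)
Lemma equivariant_limit k0 : (forall j, (k0 <= j)%N -> rpcoset (@stab G j)) ->
  exists x : G, forall j, (k0 <= j)%N -> pi (stab j) x.
Proof.
move=> rS.
have /choice[x xP] : forall j, exists x : G, (k0 <= j)%N -> pi (stab j) x.
  move=> j; case: (leqP k0 j) => [kj|_]; last by exists 1%g.
  by have [_ [[x px] _] _] := piE.1 _ (rS _ kj); exists x.
have stable i j : (k0 <= i)%N -> (i <= j)%N -> agree i (pfun (x j)) (pfun (x i)).
  move=> ki ij; have kj := leq_trans ki ij.
  apply/(equivariant_stab _ (rS _ ki) (xP _ ki)).
  apply: (equivariantS piE (rS _ kj) (rS _ ki) (@stabS G _ _ ij)).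
  exact: xP.
pose m i := maxn k0 i.+1.
pose f i := pfun (x (m i)) i.
have fE i j : (m i <= j)%N -> pfun (x j) i = f i.
  move=> mj; apply: (stable (m i) j) => //; first exact: leq_maxl.
  exact: leq_maxr.
have f_inj : injective f.
  move=> i i' ff; pose j := maxn (m i) (m i').
  by apply: (@pfun_inj _ (x j)); rewrite !fE ?leq_maxl ?leq_maxr.
have f_surj i : exists l, f l = i.
  pose n := maxn k0 i.+1; have kn : (k0 <= n)%N by exact: leq_maxl.
  have rn := rS _ kn; have rA := piE'.1 _ rn.
  have [_ [[a Aa] _] _] := rA.
  pose W := rtrans (pi' (stab n)) a^-1%g.
  have rW : rpcoset W by exact: rpcoset_rtrans.
  have [l lW] : exists l, stab l `<=` W.
    apply/stab_base; apply: open_nbhs_nbhs; split; first by case: rW.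
    by rewrite /W/rtrans/= invgK mul1g.
  exists (pfun a i); pose j := maxn (maxn k0 l) (m (pfun a i)).
  have kj : (k0 <= j)%N by rewrite !leq_max leqnn.
  have lj : (l <= j)%N by rewrite !leq_max leqnn orbT.
  rewrite -(fE _ j) ?leq_maxr// -pfunM.
  suff : stab n (x j * a)%g by apply; exact: leq_maxr.
  rewrite -[stab n]piK'//.
  have : pi W (x j).
    apply: (equivariantS piE (rS _ kj) rW) (xP _ kj).
    by apply: subset_trans lW; exact: stabS.
  by rewrite /W (equivariant_rtrans piE _ rA) /rtrans/= invgK.
have f_bij : bijective f.
  have [h hK] := choice f_surj.
  by exists h => // i; apply: f_inj; rewrite hK.
pose p := mkSinf f_bij.
have Gp : cset G p.
  apply: (cset_closed (G := G)) => N /Sinf_nbhs_base[k kN].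
  pose j := \max_(i < k) m i.
  exists (\val (x j) : Sinf); split; first exact: set_valP.
  apply: kN => i ik; rewrite -[LHS]/(pfun (x j) i) fE//.
  exact: (leq_bigmax (Ordinal ik)).
pose y : G := SigSub (mem_set Gp).
exists y => j kj; apply/(equivariant_stab _ (rS _ kj) (xP _ kj)) => i ij.
rewrite -[LHS]/(f i) -(fE i (maxn j (m i))) ?leq_maxr//.
by apply: (stable j) => //; exact: leq_maxl.
Qed.

(** The limit x lies in pi(W) for each open subgroup W among the cosets. For a in
    A, the coset A is W a with W = A a^-1, so x a lies in pi(A). *)
Lemma equivariant_translation A0 : @rpcoset G A0 ->
  exists x : G, forall A, rpcoset A -> pi A = ltrans x A.
Proof.
move=> /rpcoset_stab[k0 rS]; have [x xP] := equivariant_limit rS.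
exists x => A rA; have [oA [[a Aa] cA] _] := rA.
have xA b : A b -> pi A (x * b)%g.
  move=> Ab; pose W := rtrans A b^-1%g.
  have rW : rpcoset W by exact: rpcoset_rtrans.
  have [l lW] : exists l, stab l `<=` W.
    apply/stab_base; apply: open_nbhs_nbhs; split; first by case: rW.
    by rewrite /W/rtrans/= invgK mul1g.
  have : pi W x.
    have kj : (k0 <= maxn k0 l)%N by exact: leq_maxl.
    apply: (equivariantS piE (rS _ kj) rW) (xP _ kj).
    by apply: subset_trans lW; apply: stabS; exact: leq_maxr.
  by rewrite /W (equivariant_rtrans piE _ rA) /rtrans/= invgK.
apply/seteqP; split=> [y Ay|y /xA]; last by rewrite mulVKg.
have /(equivariantP piE piE' piK y rA Aa) := xA _ Aa.
by move=> [/(_ Ay)+ _]; rewrite invgM -mulgA mulVKg.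
Qed.

End translation.

(** * The structure of cosets determines the group *)

Definition ternary_iso X Y (D : set X) (R : X -> X -> X -> Prop)
    (D' : set Y) (R' : Y -> Y -> Y -> Prop) (f : X -> Y) (g : Y -> X) : Prop :=
  [/\ set_fun D D' f, set_fun D' D g,
      (forall x, D x -> g (f x) = x), (forall y, D' y -> f (g y) = y) &
      forall x y z, D x -> D y -> D z -> R x y z <-> R' (f x) (f y) (f z)].

Lemma ternary_iso_sym X Y (D : set X) R (D' : set Y) R' f g :
  ternary_iso D R D' R' f g -> ternary_iso D' R' D R g f.
Proof.
move=> [fD gD fK gK fR]; split=> // x y z Dx Dy Dz.
by rewrite fR ?gK//; exact: gD.
Qed.

Definition prod_sub (G : topGroupType) (A B C : set G) : Prop :=
  prodset A B `<=` C.

Definition coset_iso (G H : topGroupType) :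
    (set G -> set H) -> (set H -> set G) -> Prop :=
  ternary_iso (@rpcosets G) (@prod_sub G) (@rpcosets H) (@prod_sub H).

Lemma rpcoset_preimage (G H : topGroupType) (f : G -> H) (g : H -> G)
    (A : set G) : cancel f g -> cancel g f -> {morph f : x y / (x * y)%g} ->
  continuous f -> continuous g -> rpcoset A -> rpcoset (g @^-1` A).
Proof.
move=> fK gK fM cf cg [oA [[a Aa] cA] rA].
have gM : {morph g : x y / (x * y)%g}.
  by move=> x y; rewrite -{1}(gK x) -{1}(gK y) -fM fK.
have g1 : g 1%g = 1%g by apply: (mulgI (g 1%g)); rewrite -gM !mulg1.
have f1 : f 1%g = 1%g by rewrite -g1 gK.
have gV x : g x^-1%g = (g x)^-1%g.
  by apply/esym/mulg1_eq; rewrite -gM mulgV.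
split; first by move/continuousP: cg; exact.
  split; first by exists (f a); rewrite /= fK.
  by move=> x y z /= Ax Ay Az; rewrite !gM gV; exact: cA.
move=> N N1; have /rA[F fF AF] : nbhs 1%g (f @^-1` N) by apply: cf; rewrite f1.
exists (f @` F); first exact: finite_image.
move=> y /AF[_ [n Nn [u Fu <-]] [m Nm E]].
rewrite -(gK y) -E !fM; exists (f n * f u)%g; last by exists (f m).
by exists (f n) => //; exists (f u) => //; exists u.
Qed.

Lemma topgroup_isom_coset_iso (G H : topGroupType) : topgroup_isom G H ->
  exists theta theta', @coset_iso G H theta theta'.
Proof.
move=> [f [g [fK gK fM cf cg]]].
have gM : {morph g : x y / (x * y)%g}.
  by move=> x y; rewrite -{1}(gK x) -{1}(gK y) -fM fK.
exists (preimage g), (preimage f); split.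
- by move=> A; exact: (rpcoset_preimage fK gK fM cf cg).
- by move=> A; exact: (rpcoset_preimage gK fK gM cg cf).
- by move=> A _; apply/seteqP; split=> x; rewrite /= fK.
- by move=> A _; apply/seteqP; split=> x; rewrite /= gK.
move=> A B C _ _ _; split=> AB x [a Aa [b Bb <-]].
  by rewrite /= gM; apply: AB; exists (g a) => //; exists (g b).
rewrite -(fK (a * b)%g) fM; apply: AB.
by exists (f a); rewrite /= ?fK//; exists (f b); rewrite /= ?fK.
Qed.

Section recover.
Variables (G H : closed_subgroup) (theta : set G -> set H) (theta' : set H -> set G).
Hypothesis thetaP : coset_iso theta theta'.

(** Transporting a translation of G along theta yields a bijection of the cosets of
    H to which the characterization of translations applies. *)
Lemma coset_iso_conj_equivariant (g : G) :
  equivariant (fun B => theta (ltrans g (theta' B))).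
Proof.
have [tD tD' tK tK' tR] := thetaP.
split=> [B rB|A B C rA rB rC].
  by apply: tD; apply: rpcoset_ltrans; exact: tD'.
have [_ _ _ _ tR'] := ternary_iso_sym thetaP.
move=> /(tR' _ _ _ rA rB rC) AB.
have ABg : prod_sub (ltrans g (theta' A)) (theta' B) (ltrans g (theta' C)).
  move=> _ [a Aa [b Bb <-]]; rewrite /ltrans/= mulgA; apply: AB.
  by exists (g^-1 * a)%g => //; exists b.
rewrite -[X in prodset _ X](tK' _ rB).
by apply: (iffLR (tR _ _ _ _ _ _) ABg); do ?apply: rpcoset_ltrans; exact: tD'.
Qed.

Lemma coset_iso_translation (A0 : set H) : rpcoset A0 -> forall g : G,
  exists h : H, forall A, rpcoset A -> theta (ltrans g A) = ltrans h (theta A).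
Proof.
have [tD tD' tK tK' tR] := thetaP.
move=> rA0 g.
have conjK x B : rpcoset B ->
    theta (ltrans x (theta' (theta (ltrans x^-1%g (theta' B))))) = B.
  move=> rB; rewrite tK; first by rewrite ltransM mulgV ltrans1 tK'.
  by apply: rpcoset_ltrans; exact: tD'.
have [||h hP] := equivariant_translation (coset_iso_conj_equivariant g)
    (coset_iso_conj_equivariant g^-1%g) _ _ rA0.
- by move=> B rB; rewrite -{2}[g]invgK conjK.
- by move=> B rB; rewrite conjK.
by exists h => A rA; rewrite -hP ?tK//; exact: tD.
Qed.

(** For a small subgroup V of H with preimage U, phi y lies in (phi g) V as soon
    as y U = g U, which holds for y in the open set g U. *)
Lemma coset_iso_continuous (phi : G -> H) (A0 : set H) : rpcoset A0 ->
  (forall g A, rpcoset A -> theta (ltrans g A) = ltrans (phi g) (theta A)) ->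
  continuous phi.
Proof.
have [tD tD' tK tK' tR] := thetaP.
have [_ _ _ _ tR'] := ternary_iso_sym thetaP.
move=> /rpcoset_stab[k0 rS] phiP g N /group_of_nbhs_base[k1 kN].
pose k := maxn k0 k1; have rk := rS k (leq_maxl _ _).
have rU := tD' _ rk; pose U := theta' (stab k).
have UU : prodset U U `<=` U.
  apply: (iffLR (tR' _ _ _ rk rk rk)) => _ [x xk [y yk <-]].
  exact: stabM.
have U1 : U 1%g.
  have [_ [[a Ua] cU] _] := rU.
  have := cU _ _ _ Ua (UU (a * a)%g _) Ua; rewrite invgM !mulgA mulgV mul1g mulVg.
  by apply; exists a => //; exists a.
have oU : open (ltrans g U) by apply: open_ltrans; case: rU.
apply: filterS (open_nbhs_nbhs (conj oU _)); last by rewrite /ltrans/= mulVg.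
move=> y; rewrite /ltrans/= => Uy.
suff E : ltrans (phi g) (stab k) (phi y).
  apply: kN => i ik; apply: (iffLR (stab_coset _ _ _) E).
  by rewrite leq_max ik orbT.
have : ltrans (phi y) (stab k) (phi y) by rewrite /ltrans/= mulVg; exact: stab1.
rewrite -(tK' _ rk) -!phiP//; congr (theta _ _).
have [_ [_ cU] _] := rU.
have VU z : U z -> U z^-1%g by move=> Uz; have := cU _ _ _ U1 Uz U1; rewrite mul1g mulg1.
apply/seteqP; split=> z; rewrite /ltrans/= => Uz.
  rewrite -(mulVKg y z) mulgA; apply: UU.
  by exists (g^-1 * y)%g => //; exists (y^-1 * z)%g.
rewrite -(mulVKg g z) mulgA; apply: UU; exists (y^-1 * g)%g.
  by have := VU _ Uy; rewrite invgM invgK.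
by exists (g^-1 * z)%g.
Qed.

Lemma translation_inj (A0 : set H) (x y : H) : rpcoset A0 ->
  (forall A : set H, rpcoset A -> ltrans x A = ltrans y A) -> x = y.
Proof.
move=> /rpcoset_stab[k0 rS] xy; apply/val_inj/SinfP => i.
pose k := maxn k0 i.+1.
have : ltrans x (stab k) x by rewrite /ltrans/= mulVg; exact: stab1.
rewrite xy; last by apply: rS; exact: leq_maxl.
by move=> /(iffLR (stab_coset _ _ _)); apply; exact: leq_maxr.
Qed.

End recover.

Lemma coset_iso_topgroup_isom (G H : closed_subgroup)
    (theta : set G -> set H) (theta' : set H -> set G)
    (A0 : set G) (B0 : set H) : rpcoset A0 -> rpcoset B0 ->
  coset_iso theta theta' -> topgroup_isom G H.
Proof.
move=> rA0 rB0 tP; have tP' := ternary_iso_sym tP.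
have [phi phiP] := choice (coset_iso_translation tP rB0).
have [psi psiP] := choice (coset_iso_translation tP' rA0).
have [tD tD' tK tK' _] := tP.
exists phi, psi; split.
- move=> g; apply: (translation_inj rA0) => A rA.
  rewrite -{1}(tK _ rA) -psiP; last exact: tD.
  by rewrite -phiP// tK//; exact: rpcoset_ltrans.
- move=> h; apply: (translation_inj rB0) => A rA.
  rewrite -{1}(tK' _ rA) -phiP; last exact: tD'.
  by rewrite -psiP// tK'//; exact: rpcoset_ltrans.
- move=> x y; apply: (translation_inj rB0) => B rB.
  have rA := tD' _ rB; rewrite -(tK' _ rB) -phiP// -!ltransM !phiP//.
  exact: rpcoset_ltrans.
- exact: (coset_iso_continuous tP rB0 phiP).
- exact: (coset_iso_continuous tP' rA0 psiP).
Qed.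

(** * The four classes have such cosets *)

Lemma compact_rcovered (G : topGroupType) (K : set G) : compact K -> rcovered K.
Proof.
move=> /compact_near_coveringP cK N N1.
pose F : set_system (set G) :=
  filter_from (@finite_set G) (fun E0 => [set E | E0 `<=` E]).
have FF : Filter F.
  apply: filter_from_filter; first by exists set0; exact: finite_set0.
  move=> E E' fE fE'; exists (E `|` E'); first by rewrite finite_setU.
  by move=> E'' EE; split=> x Ex; apply: EE; [left|right].
have [x Kx|E fE EK] := cK _ F (fun E y => exists2 x, E x & N (x^-1 * y)%g) FF.
  exists (ltrans x N, [set E | [set x] `<=` E]); first split => /=.
  - apply: (@mulg_continuousl _ x^-1%g x); by rewrite mulVg.
  - by exists [set x].
  - by move=> [y E] [/= Ny Ex]; exists x => //; apply: Ex.
exists E => // y /(EK E (@subset_refl _ E))[x Ex Nxy].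
exists x; last by exists (x^-1 * y)%g => //; rewrite mulVKg.
by exists 1%g; [exact: nbhs_singleton|exists x => //; rewrite mul1g].
Qed.

Lemma roelcke_precompactP (G : topGroupType) :
  roelcke_precompact G <-> rcovered [set: G].
Proof.
split=> rG N N1; have [F fF NF] := rG N N1; exists F => //; first by rewrite NF.
by apply/seteqP; split.
Qed.

Lemma rcovered_rpcosetT (G : topGroupType) :
  rcovered [set: G] -> rpcoset [set: G].
Proof. by split=> //; [exact: openT|split=> //; exists 1%g]. Qed.

Lemma locally_compact_rpcoset (G : closed_subgroup) :
  locally_compact [set: G] -> exists A : set G, rpcoset A.
Proof.
move=> /(_ 1%g Logic.I)[K K1 [/compact_rcovered cK _]].
have /stab_base[k kK] : nbhs 1%g K 
  by have : nbhs 1%g [set x | [set: G] x -> K x] := K1; apply: filterS => x; exact.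
exists (stab k); split; first exact: open_stab.
  split; first by exists 1%g.
  by move=> x y z xk yk zk; apply: stabM => //; apply: stabM => //; apply: stabV.
exact: rcoveredS cK.
Qed.

Lemma compact_locally_compact (G : topGroupType) :
  compact [set: G] -> locally_compact [set: G].
Proof.
move=> cG x _; exists setT; first exact: filterT.
by split=> //; exact: closedT.
Qed.

Lemma compact_roelcke_precompact (G : topGroupType) :
  compact [set: G] -> roelcke_precompact G.
Proof. by move=> cG; apply/roelcke_precompactP; exact: compact_rcovered. Qed.

(** The double coset of g by the stabilizer of 0, ..., k-1 is determined by the
    orbit of the 2k-tuple (0, ..., k-1, g 0, ..., g (k-1)). *)
Lemma oligomorphic_roelcke_precompact (G : closed_subgroup) :
  oligomorphic G -> roelcke_precompact G.
Proof.
move=> oG; apply/roelcke_precompactP => N /stab_base[k kN].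
pose t (g : G) : (k + k).-tuple nat :=
  [tuple (if i < k then i : nat else pfun g (i - k))%N | i < k + k].
pose orb (g : G) := tuple_orbit G (t g).
have fin : finite_set (range orb).
  by apply: sub_finite_set (oG (k + k)%N) => _ [g _ <-]; exists (t g).
have [F fF orbF] : exists2 F : set G, finite_set F & forall g, exists2 f, F f & orb f = orb g.
  have /choice[r rP] : forall O, exists f : G, range orb O -> orb f = O.
    move=> O; case: (pselect (range orb O)) => [[g _ gO]|]; last by exists 1%g.
    by exists g.
  exists (r @` range orb); first exact: finite_image.
  move=> g; exists (r (orb g)); last by apply: rP; exists g.
  by exists (orb g) => //; exists g.
exists F => // g _; have [f Ff fg] := orbF g.
have : orb g (t g).
  rewrite /orb /tuple_orbit; exists (1%g : G) => //.
  by apply: eq_from_tnth => i; rewrite tnth_map.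
rewrite -fg => -[u _ uE].
have Ei i : pfun u (tnth (t f) i) = tnth (t g) i.
  by rewrite -uE [RHS]tnth_map.
have uk : stab k u.
  move=> i ik; have := Ei (Ordinal (ltn_addr k ik)).
  by rewrite !tnth_mktuple /= ik.
have ug i : (i < k)%N -> pfun u (pfun f i) = pfun g i.
  move=> ik; have lt : (k + i < k + k)%N by rewrite ltn_add2l.
  have := Ei (Ordinal lt).
  by rewrite !tnth_mktuple /= ltnNge leq_addr/= addKn.
exists (u * f)%g; first by exists u; [exact: kN|exists f].
exists ((u * f)^-1 * g)%g; last by rewrite mulVKg.
by apply: kN; apply/stab_coset => i ik; rewrite pfunM ug.
Qed.

(** * Coding a ternary structure in a graph *)

Lemma infinite_nat_set_bij (A B : set nat) : infinite_set A -> infinite_set B ->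
  exists q, set_bij A B q.
Proof.
have cardT (S : set nat) : infinite_set S -> (S #= [set: nat])%card.
  by move=> /infiniteP iS; apply/card_eqPle; split=> //; exact: subset_card_le.
move=> /cardT iA /cardT iB; apply/card_set_bijP.
by apply: card_eq_trans iA _; rewrite card_eq_sym.
Qed.

Lemma fiberwise_bijection V V' (nu : nat -> V) (nu' : nat -> V')
    (f : V -> V') (g : V' -> V) :
  (forall n, g (f (nu n)) = nu n) -> (forall n, f (g (nu' n)) = nu' n) ->
  (forall n, infinite_set [set m | nu m = g (nu' n)]) ->
  (forall n, infinite_set [set m | nu' m = f (nu n)]) ->
  exists2 p, bijective p & forall n, nu' (p n) = f (nu n).
Proof.
move=> fK gK inf inf'.
pose S v := [set m | nu m = v]; pose S' v := [set m | nu' m = f v].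
have /choice[q qP] v : exists q, (exists n, v = nu n) -> set_bij (S v) (S' v) q.
  case: (pselect (exists n, v = nu n)) => [[n ->]|]; last by exists id.
  have [m mE] := infinite_setN0 (inf' n).
  have [q qP] : exists q, set_bij (S (nu n)) (S' (nu n)) q.
    apply: infinite_nat_set_bij; last exact: inf'.
    by have := inf m; rewrite mE fK.
  by exists q.
pose p n := q (nu n) n.
have pP n : nu' (p n) = f (nu n).
  have [qS _ _] := qP (nu n) (ex_intro _ n erefl).
  exact: (qS n).
exists p => //.
have p_inj : injective p.
  move=> n m pnm; have E : nu n = nu m by rewrite -[LHS]fK -pP pnm pP fK.
  have [_ qi _] := qP (nu n) (ex_intro _ n erefl).
  apply: qi; rewrite ?inE /S//=; by move: pnm; rewrite /p E.
have p_surj m : exists n, p n = m.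
  have [n nE] := infinite_setN0 (inf m).
  have [_ _ qs] := qP (nu n) (ex_intro _ n erefl).
  have [|l lE <-] := qs m; first by rewrite /S'/= nE gK.
  by exists l; rewrite /p lE.
have [h hK] := choice p_surj.
by exists h => // i; apply: p_inj; rewrite hK.
Qed.

(** The vertices Path i a b c, for i < 4, form the path attached to the triple
    (a, b, c). Junk is an isolated vertex, denoted by the meaningless names. *)
Inductive vertex (T : Type) :=
  Junk | Elt of T | Path of nat & T & T & T.
Arguments Junk {T}.

Definition vmap X Y (f : X -> Y) (v : vertex X) : vertex Y :=
  match v with
  | Junk => Junk
  | Elt a => Elt (f a)
  | Path i a b c => Path i (f a) (f b) (f c)
  end.

(** Elements carry a loop and are not adjacent to one another; the path vertex
    of index i is joined to the i-th member of its triple for i = 1, 2, 3. The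
    vertex of index 0, which has no such neighbour, gives the path a direction. *)
Definition vertex_arc T (v w : vertex T) : Prop :=
  match v, w with
  | Elt a, Elt b => a = b
  | Path i a b c, Elt x =>
      [\/ i = 1%N /\ x = a, i = 2%N /\ x = b | i = 3%N /\ x = c]
  | Path i a b c, Path j a' b' c' => j = i.+1 /\ [/\ a = a', b = b' & c = c']
  | _, _ => False
  end.

Definition vertex_edge T (v w : vertex T) : Prop := vertex_arc v w \/ vertex_arc w v.

Lemma edgeC T (v w : vertex T) : vertex_edge v w <-> vertex_edge w v.
Proof. by rewrite /vertex_edge orC. Qed.

Lemma edge_loop T (v : vertex T) : vertex_edge v v <-> exists a, v = Elt a.
Proof.
split=> [|[a ->]]; last by left.
case: v => [|a|i a b c] /=; first by case.
  by exists a.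
by case=> -[/esym/eqP]; rewrite eqn_leq ltnn.
Qed.

Lemma edge_Junk T (w : vertex T) : ~ vertex_edge Junk w.
Proof. by case: w => [|a|i a b c] [] []. Qed.

Lemma edge_Path_Elt T i (a b c x : T) : vertex_edge (Path i a b c) (Elt x) ->
  [\/ i = 1%N /\ x = a, i = 2%N /\ x = b | i = 3%N /\ x = c].
Proof. by case=> [|[]]. Qed.

Lemma edge_Path T i (a b c : T) (w : vertex T) : vertex_edge (Path i a b c) w ->
  ~ (exists x, w = Elt x) ->
  exists2 j, w = Path j a b c & j = i.+1 \/ i = j.+1.
Proof.
case: w => [|x|j a' b' c'].
- by rewrite edgeC => /edge_Junk.
- by move=> _ []; exists x.
- by move=> [[ji [<- <- <-]]|[ij [-> -> ->]]] _; exists j; [|left| |right].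
Qed.

Section naming.
Variables (T : Type) (D : set T) (R : T -> T -> T -> Prop).

Definition is_vertex (v : vertex T) : Prop :=
  match v with
  | Junk => True
  | Elt a => D a
  | Path i a b c => (i < 4)%N /\ [/\ D a, D b, D c & R a b c]
  end.

Definition naming (nu : nat -> vertex T) : Prop :=
  (forall n, is_vertex (nu n)) /\
  (forall v, is_vertex v -> infinite_set [set n | nu n = v]).

(** Vertices are replaced by infinite sets of names; a loop becomes a clique. *)
Definition blowup (nu : nat -> vertex T) (x y : nat) : Prop :=
  x <> y /\ vertex_edge (nu x) (nu y).

Lemma naming_avoid nu v x y : naming nu -> is_vertex v ->
  exists z, [/\ nu z = v, z <> x & z <> y].
Proof.
move=> [_ inf] /inf iv; apply: contrapT => nz.
apply: iv; apply: sub_finite_set (finite_set2 x y) => z zv /=.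
by apply: contrapT => /not_orP[zx zy]; apply: nz; exists z.
Qed.

End naming.

(** The names of an element are the vertices of the blowup that have an
    adjacent twin, which makes them definable in the graph. *)
Definition true_twin (e : nat -> nat -> Prop) (x y : nat) : Prop :=
  [/\ x <> y, e x y & forall z, z <> x -> z <> y -> (e x z <-> e y z)].

Definition in_clique (e : nat -> nat -> Prop) (x : nat) : Prop :=
  exists y, true_twin e x y.

(** This defines the ternary relation in the graph. Requiring x3 not to be
    adjacent to x0 prevents x3 from being another name of x1. *)
Definition linked (e : nat -> nat -> Prop) (a b c : nat) : Prop :=
  exists x0 x1 x2 x3,
    [/\ [/\ ~ in_clique e x0, ~ in_clique e x1, ~ in_clique e x2 &
            ~ in_clique e x3],
        [/\ (forall w, e x0 w -> ~ in_clique e w), e x0 x1, e x1 x2, e x2 x3 &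
            ~ e x3 x0] &
        [/\ e x1 a, e x2 b & e x3 c]].

(** If x is not the name of an element, another name x' of the same vertex is not
    adjacent to x but is adjacent to each neighbour y of x, so y is not a twin. *)
Lemma in_clique_blowup T D R (nu : nat -> vertex T) x : naming D R nu ->
  in_clique (blowup nu) x <-> exists a, nu x = Elt a.
Proof.
move=> nm; rewrite -edge_loop; split.
  move=> [y [xy [_ exy] tw]]; apply: contrapT => nl.
  have [x' [x'E x'x x'y]] := naming_avoid x y nm (nm.1 x).
  have [_] : blowup nu x x'.
    by apply/tw => //; split; [apply: nesym|rewrite x'E edgeC].
  by rewrite x'E.
move=> xx; have [y [yE yx _]] := naming_avoid x x nm (nm.1 x).
exists y; split; [exact: nesym|by split; [exact: nesym|rewrite yE]|].
by move=> z zx zy; rewrite /blowup yE; split=> -[_ ?]; split=> //; exact: nesym.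
Qed.

Lemma linked_blowup T D R (nu : nat -> vertex T) x y z a b c : naming D R nu ->
  nu x = Elt a -> nu y = Elt b -> nu z = Elt c ->
  linked (blowup nu) x y z <-> R a b c.
Proof.
move=> nm xE yE zE; split.
  move=> [x0 [x1 [x2 [x3 [[nc0 nc1 nc2 nc3] [c0 e01 e12 e23 e30] [e1 e2 e3]]]]]].
  move: nc0 nc1 nc2 nc3; rewrite !(in_clique_blowup _ nm) => nc0 nc1 nc2 nc3.
  have V0 := nm.1 x0; case E0 : (nu x0) V0 => [|a0|i a0 b0 d0] /=.
  - by move: e01.2; rewrite E0 => /edge_Junk.
  - by move: nc0; rewrite E0 => -[]; exists a0.
  move=> [i4 [Da0 Db0 Dc0 Rabc]].
  (* A path vertex of index 1, 2 or 3 has a neighbour among the elements, so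
     the end x0, whose neighbours all lie outside cliques, has index 0. *)
  have i0 : i = 0%N.
    have nElt p : D p -> ~ vertex_edge (Path i a0 b0 d0) (Elt p).
      move=> Dp ep; have [w [wE wx0 _]] := @naming_avoid _ D R nu (Elt p) x0 x0 nm Dp.
      apply: (c0 w); last by rewrite (in_clique_blowup _ nm); exists p.
      by split; [exact: nesym|rewrite E0 wE].
    move: i4 {E0} nElt; case: i => [//|[|[|[|//]]]] _ nElt; exfalso.
    - by apply: (nElt _ Da0); left; apply: Or31.
    - by apply: (nElt _ Db0); left; apply: Or32.
    - by apply: (nElt _ Dc0); left; apply: Or33.
  rewrite {}i0 {i4} in E0.
  have [i1 E1 [i1E|//]] : exists2 j, nu x1 = Path j a0 b0 d0 & j = 1%N \/ 0%N = j.+1.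
    by apply: edge_Path => //; rewrite -E0; exact: e01.2.
  rewrite {}i1E in E1.
  have ea : vertex_edge (Path 1 a0 b0 d0) (Elt a) by rewrite -E1 -xE; exact: e1.2.
  case: (edge_Path_Elt ea) => -[] // _ aE.
  have [i2 E2 i2E] : exists2 j, nu x2 = Path j a0 b0 d0 & j = 2%N \/ 1%N = j.+1.
    by apply: edge_Path => //; rewrite -E1; exact: e12.2.
  have eb : vertex_edge (Path i2 a0 b0 d0) (Elt b) by rewrite -E2 -yE; exact: e2.2.
  case: i2E => [i2E|[i2E]]; last first.
    by rewrite -i2E in eb; case: (edge_Path_Elt eb) => -[].
  rewrite {}i2E in E2 eb; case: (edge_Path_Elt eb) => -[] // _ bE.
  have [i3 E3 i3E] : exists2 j, nu x3 = Path j a0 b0 d0 & j = 3%N \/ 2%N = j.+1.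
    by apply: edge_Path => //; rewrite -E2; exact: e23.2.
  case: i3E => [i3E|[i3E]].
    rewrite {}i3E in E3.
    have ec : vertex_edge (Path 3 a0 b0 d0) (Elt c) by rewrite -E3 -zE; exact: e3.2.
    by case: (edge_Path_Elt ec) => -[] // _ cE; rewrite aE bE cE.
  exfalso; apply: e30; split; last by rewrite E3 E0 -i3E; right.
  by move=> x30; move: E0; rewrite -x30 E3 -i3E.
move=> Rabc.
have := nm.1 x; have := nm.1 y; have := nm.1 z; rewrite xE yE zE /= => Dc Db Da.
have ex i : (i < 4)%N -> exists n, nu n = Path i a b c.
  move=> i4; have [n [nE _ _]] := @naming_avoid _ D R nu (Path i a b c) 0%N 0%N nm
    (conj i4 (And4 Da Db Dc Rabc)); by exists n.
have [x0 E0] := ex 0%N isT; have [x1 E1] := ex 1%N isT.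
have [x2 E2] := ex 2%N isT; have [x3 E3] := ex 3%N isT.
have ne v w : nu v <> nu w -> v <> w by move=> vw E; apply: vw; rewrite E.
exists x0, x1, x2, x3; split.
- by split; rewrite (in_clique_blowup _ nm) ?E0 ?E1 ?E2 ?E3 => -[].
- split.
  + move=> w [_]; rewrite (in_clique_blowup _ nm) E0 => e [a' wE]; move: e.
    by rewrite wE => -[[[]|[]|[]]|].
  + by split; [apply: ne|left]; rewrite E0 E1.
  + by split; [apply: ne|left]; rewrite E1 E2.
  + by split; [apply: ne|left]; rewrite E2 E3.
  + by rewrite /blowup E3 E0 => -[_] [] [].
- split; split; try by apply: ne; rewrite ?E1 ?E2 ?E3 ?xE ?yE ?zE.
  + by left; rewrite E1 xE /=; apply: Or31.
  + by left; rewrite E2 yE /=; apply: Or32.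
  + by left; rewrite E3 zE /=; apply: Or33.
Qed.

Lemma true_twin_iso (e e' : nat -> nat -> Prop) p x y : bijective p ->
  (forall x y, e x y <-> e' (p x) (p y)) ->
  true_twin e x y <-> true_twin e' (p x) (p y).
Proof.
move=> [q pK qK] pe; split=> -[xy exy tw]; split.
- by move=> /(can_inj pK).
- exact/pe.
- move=> z zx zy; rewrite -(qK z) -!pe; apply: tw => E.
    by apply: zx; rewrite -E qK.
  by apply: zy; rewrite -E qK.
- by move=> E; apply: xy; rewrite E.
- exact/pe.
- by move=> z zx zy; rewrite !pe; apply: tw => /(can_inj pK).
Qed.

Lemma in_clique_iso (e e' : nat -> nat -> Prop) p x : bijective p ->
  (forall x y, e x y <-> e' (p x) (p y)) -> in_clique e x -> in_clique e' (p x).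
Proof.
by move=> bp pe [y] /(true_twin_iso _ _ bp pe) ?; exists (p y).
Qed.

Lemma in_clique_isoV (e e' : nat -> nat -> Prop) p x : bijective p ->
  (forall x y, e x y <-> e' (p x) (p y)) -> in_clique e' (p x) -> in_clique e x.
Proof.
move=> bp pe [y]; case: (bp) => q pK qK; rewrite -(qK y).
by move=> /(true_twin_iso _ _ bp pe) ?; exists (q y).
Qed.

Lemma linked_iso (e e' : nat -> nat -> Prop) p a b c : bijective p ->
  (forall x y, e x y <-> e' (p x) (p y)) ->
  linked e a b c -> linked e' (p a) (p b) (p c).
Proof.
move=> bp pe [x0 [x1 [x2 [x3 [[n0 n1 n2 n3] [c0 e01 e12 e23 e30] [e1 e2 e3]]]]]].
exists (p x0), (p x1), (p x2), (p x3); split.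
- by split=> /(in_clique_isoV bp pe).
- split; [|exact/pe|exact/pe|exact/pe|by move=> /pe].
  case: (bp) => q pK qK w; rewrite -(qK w) => /pe ew.
  by move=> /(in_clique_isoV bp pe); exact: c0.
- by split; exact/pe.
Qed.


Lemma vmap_is_vertex X Y (D : set X) R (D' : set Y) R' f g v :
  ternary_iso D R D' R' f g -> is_vertex D R v -> is_vertex D' R' (vmap f v).
Proof.
move=> [fD _ _ _ fR]; case: v => //= [i a b c [i4 [Da Db Dc Rabc]]].
by split=> //; split; [exact: fD|exact: fD|exact: fD|exact/fR].
Qed.

Lemma vmapK X Y (D : set X) R (D' : set Y) R' f g v :
  ternary_iso D R D' R' f g -> is_vertex D R v -> vmap g (vmap f v) = v.
Proof.
move=> [_ _ fK _ _]; case: v => //= [a /fK-> //|i a b c [_ [Da Db Dc _]]].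
by rewrite !fK.
Qed.

Lemma vmap_arc X Y (f : X -> Y) v w : vertex_arc v w -> vertex_arc (vmap f v) (vmap f w).
Proof.
case: v w => [|a|i a b c] [|x|j x y z] //=; first by move->.
  by move=> [[-> ->]|[-> ->]|[-> ->]]; [apply: Or31|apply: Or32|apply: Or33].
by move=> [-> [-> -> ->]].
Qed.

Lemma vmap_edge X Y (f : X -> Y) v w : vertex_edge v w -> vertex_edge (vmap f v) (vmap f w).
Proof. by move=> [] /(vmap_arc f) ?; [left|right]. Qed.

Lemma ternary_iso_blowup X Y (D : set X) R (D' : set Y) R' f g nu nu' :
  naming D R nu -> naming D' R' nu' -> ternary_iso D R D' R' f g ->
  exists2 p, bijective p & forall x y, blowup nu x y <-> blowup nu' (p x) (p y).
Proof.
move=> nm nm' fg; have gf := ternary_iso_sym fg.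
have [||||p bp pE] := @fiberwise_bijection _ _ nu nu' (vmap f) (vmap g).
- by move=> n; exact: (vmapK fg (nm.1 n)).
- by move=> n; exact: (vmapK gf (nm'.1 n)).
- by move=> n; apply: nm.2; exact: (vmap_is_vertex gf (nm'.1 n)).
- by move=> n; apply: nm'.2; exact: (vmap_is_vertex fg (nm.1 n)).
exists p => // x y; rewrite /blowup !pE; split=> -[xy exy]; split.
- by case: bp => q pK _ /(can_inj pK).
- exact: vmap_edge.
- by move=> E; apply: xy; rewrite E.
- by have := vmap_edge g exy; rewrite !(vmapK fg (nm.1 _)).
Qed.

Lemma blowup_ternary_map X Y (D : set X) R (D' : set Y) R' (y0 : Y) nu nu' p :
  naming D R nu -> naming D' R' nu' -> bijective p ->
  (forall x y, blowup nu x y <-> blowup nu' (p x) (p y)) ->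
  exists f : X -> Y, forall n a, nu n = Elt a -> nu' (p n) = Elt (f a).
Proof.
move=> nm nm' bp pe.
suff /choice[f fP] : forall a, exists b, forall n, nu n = Elt a -> nu' (p n) = Elt b.
  by exists f => n a; exact: fP.
move=> a; case: (pselect (exists n, nu n = Elt a)) => [[n nE]|na]; last first.
  by exists y0 => n nE; case: na; exists n.
have : in_clique (blowup nu') (p n).
  by apply: (in_clique_iso bp pe); rewrite (in_clique_blowup _ nm); exists a.
rewrite (in_clique_blowup _ nm') => -[b bE]; exists b => m mE.
have [->//|/eqP mn] := eqVneq m n.
have [_ e'mn] : blowup nu' (p m) (p n).
  by apply/pe; split=> //; rewrite mE nE; left.
have : in_clique (blowup nu') (p m).
  by apply: (in_clique_iso bp pe); rewrite (in_clique_blowup _ nm); exists a.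
rewrite (in_clique_blowup _ nm') => -[b' b'E].
by move: e'mn; rewrite b'E bE => -[] /= ->.
Qed.

Lemma blowup_ternary_iso X Y (D : set X) R (D' : set Y) R' (x0 : X) (y0 : Y)
    nu nu' p : naming D R nu -> naming D' R' nu' -> bijective p ->
  (forall x y, blowup nu x y <-> blowup nu' (p x) (p y)) ->
  exists f g, ternary_iso D R D' R' f g.
Proof.
move=> nm nm' bp pe; have [f fP] := blowup_ternary_map y0 nm nm' bp pe.
have [q pK qK] := bp; have bq : bijective q by exists p.
have qe x y : blowup nu' x y <-> blowup nu (q x) (q y) by rewrite pe !qK.
have [g gP] := blowup_ternary_map x0 nm' nm bq qe.
have name a : D a -> exists n, nu n = Elt a.
  by move=> Da; have [n [nE _ _]] := @naming_avoid _ D R nu (Elt a) 0%N 0%N nm Da; exists n.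
have name' b : D' b -> exists n, nu' n = Elt b.
  by move=> Db; have [n [nE _ _]] := @naming_avoid _ D' R' nu' (Elt b) 0%N 0%N nm' Db; exists n.
exists f, g; split.
- by move=> a /name[n nE]; have := nm'.1 (p n); rewrite (fP _ _ nE).
- by move=> b /name'[n nE]; have := nm.1 (q n); rewrite (gP _ _ nE).
- move=> a /name[n nE]; have := gP _ _ (fP _ _ nE).
  by rewrite pK nE => -[].
- move=> b /name'[n nE]; have := fP _ _ (gP _ _ nE).
  by rewrite qK nE => -[].
move=> a b c /name[x xE] /name[y yE] /name[z zE].
rewrite -(linked_blowup nm xE yE zE).
rewrite -(linked_blowup nm' (fP _ _ xE) (fP _ _ yE) (fP _ _ zE)).
split; first exact: linked_iso.
by move=> /(linked_iso bq qe); rewrite !pK.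
Qed.

(** * Borel conditions on closed subgroups *)

Section borel_prop.
Variables (d : measure_display) (X : measurableType d).
Implicit Types P Q : X -> Prop.

Definition borel_prop P : Prop := measurable [set x | P x].

Lemma borel_cst (p : Prop) : borel_prop (fun=> p).
Proof.
rewrite /borel_prop; case: (pselect p) => hp.
  by rewrite (_ : [set x : X | p] = setT); [exact: measurableT|by apply/seteqP; split].
by rewrite (_ : [set x : X | p] = set0); [exact: measurable0|by apply/seteqP; split].
Qed.

Lemma borel_iff P Q : (forall x, P x <-> Q x) -> borel_prop P -> borel_prop Q.
Proof. by move=> PQ; rewrite (_ : P = Q)//; apply/funext => x; exact/propext. Qed.

Lemma borel_not P : borel_prop P -> borel_prop (fun x => ~ P x).
Proof.
move=> mP; rewrite /borel_prop -[X in measurable X]/(~` [set x | P x]).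
exact: measurableC.
Qed.

Lemma borel_and P Q : borel_prop P -> borel_prop Q -> borel_prop (fun x => P x /\ Q x).
Proof. by move=> mP mQ; exact: (measurableI [set x | P x] [set x | Q x]). Qed.

Lemma borel_or P Q : borel_prop P -> borel_prop Q -> borel_prop (fun x => P x \/ Q x).
Proof. by move=> mP mQ; exact: (measurableU [set x | P x] [set x | Q x]). Qed.

Lemma borel_ex (I : countType) (P : I -> X -> Prop) :
  (forall i, borel_prop (P i)) -> borel_prop (fun x => exists i, P i x).
Proof.
move=> mP; pose F n := [set x | exists2 i, unpickle n = Some i & P i x].
rewrite /borel_prop (_ : [set x | exists i, P i x] = \bigcup_n F n).
  apply: bigcupT_measurable => n; rewrite /F; case: (unpickle n) => [i|].
    by apply: borel_iff (mP i) => x; split=> [Pi|[_ [<-]]//]; exists i.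
  by apply: borel_iff (borel_cst False) => x; split=> // -[].
apply/seteqP; split=> x; last by move=> [n _ [i _ Pi]]; exists i.
by move=> [i Pi]; exists (pickle i) => //; exists i => //; rewrite pickleK.
Qed.

Lemma borel_all (I : countType) (P : I -> X -> Prop) :
  (forall i, borel_prop (P i)) -> borel_prop (fun x => forall i, P i x).
Proof.
move=> mP; apply: (@borel_iff (fun x => ~ exists i, ~ P i x)).
  move=> x; split=> [H i|H [i]]; last exact.
  by apply: contrapT => nPi; apply: H; exists i.
by apply/borel_not/borel_ex => i; exact/borel_not.
Qed.

End borel_prop.

Lemma borel_hits (U : set Sinf) : open U ->
  borel_prop (fun G : closed_subgroup => exists g : G, U (\val g)).
Proof.
move=> oU; apply: (@borel_iff _ closed_subgroup
  (fun G : closed_subgroup => hits U (\val G : closed_set Sinf))).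
  move=> G; split=> [[p [Gp Up]]|[g Ug]]; last first.
    by exists (\val g); split=> //; exact: set_valP.
  by exists (SigSub (mem_set Gp)).
exists (hits U); last by rewrite setTI.
by apply: sub_sigma_algebra; exists U.
Qed.

Lemma open_local (U : set Sinf) :
  (forall p, U p -> exists n, forall q : Sinf, agree n q p -> U q) -> open U.
Proof.
move=> lU; rewrite openE => p /lU[n nU].
by apply: filterS (nbhs_agree p n) => q; exact: nU.
Qed.

Lemma agree_mkseq n (f g : nat -> nat) : agree n f g <-> mkseq f n = mkseq g n.
Proof.
split=> [fg|fg i ik]; last by rewrite -(nth_mkseq 0%N f ik) fg nth_mkseq.
by apply/eq_in_map => i; rewrite mem_iota add0n => /andP[_]; exact: fg.
Qed.

Lemma agreeS m n f g : (m <= n)%N -> agree n f g -> agree m f g.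
Proof. by move=> mn fg i im; apply: fg; exact: leq_trans mn. Qed.

Lemma open_cylinder (s : seq nat) n : open [set p : Sinf | mkseq p n = s].
Proof.
apply: open_local => p /= <-; exists n => q.
by move/agree_mkseq.
Qed.

(** Such a set O is a countable union of products of three cylinders. *)
Lemma borel_hits3 (O : Sinf -> Sinf -> Sinf -> Prop) :
  (forall x y z : Sinf, O x y z -> exists n, forall x' y' z' : Sinf,
     agree n x' x -> agree n y' y -> agree n z' z -> O x' y' z') ->
  borel_prop (fun G : closed_subgroup =>
    exists x y z : G, O (\val x) (\val y) (\val z)).
Proof.
move=> locO.
pose cyl n s (G : closed_subgroup) := exists g : G, mkseq (\val g : Sinf) n = s.
pose P (i : nat * seq nat * seq nat * seq nat) (G : closed_subgroup) :=
  let: (n, s, t, u) := i in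
  (forall x y z : Sinf,
    mkseq x n = s -> mkseq y n = t -> mkseq z n = u -> O x y z) /\
  (cyl n s G /\ (cyl n t G /\ cyl n u G)).
apply: (@borel_iff _ _ (fun G => exists i, P i G)).
  move=> G; split=> [[[[[n s] t] u] [Oi [[x xE] [[y yE] [z zE]]]]]|].
    by exists x, y, z; exact: Oi.
  move=> [x [y [z Oxyz]]]; have [n nO] := locO _ _ _ Oxyz.
  exists (n, mkseq (\val x : Sinf) n, mkseq (\val y : Sinf) n, mkseq (\val z : Sinf) n).
  split; last by split; [exists x|split; [exists y|exists z]].
  by move=> x' y' z' *; apply: nO; exact/agree_mkseq.
have mcyl n s : borel_prop (cyl n s) by exact: borel_hits (open_cylinder s n).
apply: borel_ex => -[[[n s] t] u]; apply: borel_and; first exact: borel_cst.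
by apply: borel_and => //; exact: borel_and.
Qed.

(** Continuity of a ternary operation, in terms of finite approximations. *)
Definition locally_determined (w : Sinf -> Sinf -> Sinf -> Sinf) : Prop :=
  forall (x y z : Sinf) k, exists n, forall x' y' z' : Sinf,
    agree n x' x -> agree n y' y -> agree n z' z -> agree k (w x' y' z') (w x y z).

Lemma locally_determinedM w v : locally_determined w -> locally_determined v ->
  locally_determined (fun x y z => w x y z * v x y z)%g.
Proof.
move=> lw lv x y z k; have [n nv] := lv x y z k.
pose l := \max_(i < k) (v x y z i).+1.
have [m mw] := lw x y z l; exists (maxn m n) => x' y' z' xx yy zz i ik.
have S j (f g : nat -> nat) : (j <= maxn m n)%N -> agree (maxn m n) f g -> agree j f g.
  exact: agreeS.
rewrite !SinfME nv//.
- apply: mw; [exact: S (leq_maxl _ _) xx|exact: S (leq_maxl _ _) yy|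
    exact: S (leq_maxl _ _) zz|exact: (leq_bigmax (Ordinal ik))].
- exact: S (leq_maxr _ _) xx.
- exact: S (leq_maxr _ _) yy.
- exact: S (leq_maxr _ _) zz.
Qed.

Lemma locally_determinedV w : locally_determined w ->
  locally_determined (fun x y z => (w x y z)^-1)%g.
Proof.
move=> lw x y z k; pose l := \max_(i < k) ((((w x y z)^-1)%g : Sinf) i).+1.
have [n nw] := lw x y z l; exists n => x' y' z' xx yy zz i ik.
have il : ((((w x y z)^-1)%g : Sinf) i < l)%N by exact: (leq_bigmax (Ordinal ik)).
have := nw _ _ _ xx yy zz _ il; rewrite SinfKV => E.
by rewrite -[in LHS]E SinfVK.
Qed.

(** The code (k, S), where S is a list of k-tuples, denotes the set of those g
    whose restriction to 0, ..., k-1 is the image of a tuple of S by an element of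
    the stabilizer of 0, ..., k-1. *)
Definition coset_code : Type := (nat * seq (seq nat))%type.

Section denotation.
Variable G : closed_subgroup.

Definition code_mem (c : coset_code) (s : seq nat) : Prop :=
  exists2 t, t \in c.2 &
    exists u : G, mkseq (pfun u) c.1 = iota 0 c.1 /\ [seq pfun u i | i <- t] = s.

Definition den (c : coset_code) : set G :=
  [set g | code_mem c (mkseq (pfun g) c.1)].

Lemma stab_mkseq k (u : G) : stab k u <-> mkseq (pfun u) k = iota 0 k.
Proof.
have -> : iota 0 k = mkseq id k by rewrite /mkseq map_id.
by rewrite -agree_mkseq.
Qed.

Lemma open_den c : open (den c).
Proof.
rewrite openE => g cg; apply/group_of_nbhs_base; exists c.1 => h.
by move=> /agree_mkseq; rewrite /den/= => ->.
Qed.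

(** The double coset of f is determined by the restriction of f. *)
Lemma den_double_cosets k (F : seq G) :
  den (k, [seq mkseq (pfun f) k | f <- F]) =
  prodset (prodset (stab k) [set` F]) (stab k).
Proof.
apply/seteqP; split=> [g [_ /mapP[f fF ->] [u [/stab_mkseq uk E]]]|
                       _ [_ [u uk [f fF <-]] [v vk <-]]].
  exists (u * f)%g; first by exists u => //; exists f.
  exists ((u * f)^-1 * g)%g; last by rewrite mulVKg.
  apply/stab_coset/agree_mkseq; rewrite -[RHS]/(mkseq (pfun (u * f)%g) k).
  by rewrite -E /mkseq -map_comp.
exists (mkseq (pfun f) k); first exact: map_f.
exists u; split; first exact/stab_mkseq.
rewrite /= /mkseq -map_comp; apply/eq_in_map => i; rewrite mem_iota => /andP[_ ik].
by rewrite !pfunM vk.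
Qed.

(** Some tuples in S may not be the restriction, up to the stabilizer, of an
    element of the group; these contribute nothing to the denotation. *)
Lemma rcoveredP (A : set G) :
  rcovered A <-> forall k, exists S, A `<=` den (k, S).
Proof.
split=> [rA k|dA N /stab_base[k kN]].
  have /rA[F] : nbhs 1%g (@stab G k) by apply/stab_base; exists k.
  move=> /finite_seqP[l ->] Al; exists [seq mkseq (pfun f) k | f <- l].
  by rewrite den_double_cosets.
have [S AS] := dA k.
have /choice[f fP] : forall s, exists f : G,
    (exists g : G, code_mem (k, [:: s]) (mkseq (pfun g) k)) ->
    code_mem (k, [:: s]) (mkseq (pfun f) k).
  move=> s; case: (pselect (exists g : G, code_mem (k, [:: s]) (mkseq (pfun g) k))).
    by move=> [g sg]; exists g.
  by exists 1%g.
exists [set` [seq f s | s <- S]]; first exact: finite_seq.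
move=> g /AS[s sS [u [uk E]]].
have [_ /[!inE] /eqP-> [v [vk Ev]]] := fP s (ex_intro _ g (ex_intro2 _ _ s (mem_head _ _)
  (ex_intro _ u (conj uk E)))).
have /stab_mkseq {}uk := uk; have /stab_mkseq {}vk := vk.
have w_k : stab k (u * v^-1)%g by apply: stabM => //; exact: stabV.
exists ((u * v^-1) * f s)%g.
  by exists (u * v^-1)%g; [exact: kN|exists (f s) => //=; exact: map_f].
exists ((u * v^-1 * f s)^-1 * g)%g; last by rewrite mulVKg.
apply/kN/stab_coset/agree_mkseq; rewrite -E.
have -> : mkseq (pfun (u * v^-1 * f s)%g) k =
    [seq pfun (u * v^-1)%g i | i <- mkseq (pfun (f s)) k] by rewrite /mkseq -map_comp.
rewrite -Ev -map_comp; apply: eq_map => i /=.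
by rewrite pfunM pfunK.
Qed.

Lemma rpcoset_denP c : rpcoset (den c) <->
  coset_set (den c) /\ forall k, exists S, den c `<=` den (k, S).
Proof.
by split=> [[_ ? /rcoveredP]|[? /rcoveredP]] //; split=> //; exact: open_den.
Qed.

(** For large k, A is invariant under left and right multiplication by stab k,
    so it is the union of the finitely many double cosets that meet A. *)
Lemma rpcoset_den (A : set G) : rpcoset A -> exists c, den c = A.
Proof.
move=> rA; have [_ [[a Aa] cA] covA] := rA.
have rB := rpcoset_ltrans a^-1%g rA; have rC := rpcoset_rtrans a^-1%g rA.
have [kb kB] : exists k, stab k `<=` ltrans a^-1%g A.
  apply/stab_base; apply: open_nbhs_nbhs; split; first by case: rB.
  by rewrite /ltrans/= invgK mulg1.
have [kc kC] : exists k, stab k `<=` rtrans A a^-1%g.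
  apply/stab_base; apply: open_nbhs_nbhs; split; first by case: rC.
  by rewrite /rtrans/= invgK mul1g.
pose k := maxn kb kc.
have Ak x y : A x -> stab k y -> A (x * y)%g.
  move=> Ax /(stabS (leq_maxl kb kc))/kB; rewrite /ltrans/= invgK => Aay.
  by have := cA _ _ _ Ax Aa Aay; rewrite !mulgA mulgVK.
have kA x y : stab k x -> A y -> A (x * y)%g.
  move=> /(stabS (leq_maxr kb kc))/kC; rewrite /rtrans/= invgK => Axa Ay.
  by have := cA _ _ _ Axa Aa Ay; rewrite mulgK.
have /covA[F] : nbhs 1%g (@stab G k) by apply/stab_base; exists k.
move=> /finite_seqP[l ->] Al.
exists (k, [seq mkseq (pfun f) k | f <- [seq f <- l | `[< A f >]]]).
rewrite den_double_cosets; apply/seteqP; split=> [_ [_ [u uk [f fl <-]] [v vk <-]]|g Ag].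
  by apply: Ak => //; apply: kA => //; move: fl; rewrite /= mem_filter => /andP[/asboolP].
have [_ [u uk [f fl <-]] [v vk ufv]] := Al _ Ag.
exists (u * f)%g; last by exists v.
exists u => //; exists f => //; rewrite /= mem_filter fl andbT; apply/asboolP.
have -> : f = (u^-1 * (g * v^-1))%g by rewrite -ufv mulgK mulKg.
by apply: kA; [exact: stabV|apply: Ak => //; exact: stabV].
Qed.

End denotation.

Lemma borel_code_mem c s : borel_prop (fun G : closed_subgroup => code_mem G c s).
Proof.
apply: (@borel_iff _ closed_subgroup (fun G : closed_subgroup => exists t, t \in c.2 /\
    exists u : G, [set p : Sinf | mkseq p c.1 = iota 0 c.1 /\
      [seq (p : Sinf) i | i <- t] = s] (\val u))).
  by move=> G; split=> [[t [tc tu]]|[t tc tu]]; exists t.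
apply: borel_ex => t; apply: borel_and; first exact: borel_cst.
apply: borel_hits; apply: open_local => p [pk pt].
exists (maxn c.1 (\max_(i <- t) i.+1)) => q qp; split.
  by rewrite -pk; apply/agree_mkseq; apply: agreeS qp; exact: leq_maxl.
rewrite -pt; apply/eq_in_map => i it; apply: qp; rewrite leq_max.
by apply/orP; right; exact: (@leq_bigmax_seq _ _ _ (fun i : nat => i.+1) i).
Qed.

(** Membership of g in den c depends only on a finite restriction s of g; once
    these restrictions are fixed, what remains is that the cube of G meets an open
    set. Inclusions, products and the coset property of denotations are negations
    of conditions of this form. *)
Lemma borel_den3 c1 c2 c3 c4 w : locally_determined w ->
  borel_prop (fun G : closed_subgroup => exists x y z : G,
    [/\ den c1 x, den c2 y, den c3 z &
        ~ code_mem G c4 (mkseq (w (\val x) (\val y) (\val z)) c4.1)]).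
Proof.
move=> lw.
pose O (i : seq nat * seq nat * seq nat * seq nat) (x y z : Sinf) :=
  let: (s1, s2, s3, s4) := i in
  [/\ mkseq x c1.1 = s1, mkseq y c2.1 = s2, mkseq z c3.1 = s3 &
      mkseq (w x y z) c4.1 = s4].
pose M (i : seq nat * seq nat * seq nat * seq nat) (G : closed_subgroup) :=
  let: (s1, s2, s3, s4) := i in
  code_mem G c1 s1 /\ (code_mem G c2 s2 /\ (code_mem G c3 s3 /\ ~ code_mem G c4 s4)).
apply: (@borel_iff _ closed_subgroup (fun G : closed_subgroup => exists i,
  M i G /\ exists x y z : G, O i (\val x) (\val y) (\val z))).
  move=> G; split=> [[[[[s1 s2] s3] s4] [[m1 [m2 [m3 m4]]] [x [y [z [E1 E2 E3 E4]]]]]]|].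
    by exists x, y, z; split; rewrite /den/= ?E4// /pfun ?E1 ?E2 ?E3.
  move=> [x [y [z [xc yc zc wc]]]].
  exists (mkseq (pfun x) c1.1, mkseq (pfun y) c2.1, mkseq (pfun z) c3.1,
    mkseq (w (\val x) (\val y) (\val z)) c4.1).
  by split=> //; exists x, y, z.
apply: borel_ex => -[[[s1 s2] s3] s4]; apply: borel_and.
  do 3! [apply: borel_and; first exact: borel_code_mem].
  exact/borel_not/borel_code_mem.
apply: borel_hits3 => x y z [E1 E2 E3 E4].
have [n nw] := lw x y z c4.1.
exists (maxn n (maxn c1.1 (maxn c2.1 c3.1))) => x' y' z' xx yy zz; split.
- rewrite -E1; apply/agree_mkseq; apply: agreeS xx; by rewrite !leq_max leqnn ?orbT.
- rewrite -E2; apply/agree_mkseq; apply: agreeS yy; by rewrite !leq_max leqnn ?orbT.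
- rewrite -E3; apply/agree_mkseq; apply: agreeS zz; by rewrite !leq_max leqnn ?orbT.
by rewrite -E4; apply/agree_mkseq; apply: nw; [apply: agreeS xx|apply: agreeS yy|
  apply: agreeS zz]; exact: leq_maxl.
Qed.

Lemma borel_subset c c' : borel_prop (fun G : closed_subgroup => den c `<=` @den G c').
Proof.
have lw : locally_determined (fun x _ _ => x) by move=> x y z k; exists k.
apply: borel_iff (borel_not (borel_den3 c c c c' lw)) => G; split=> [H x xc|H].
  by apply: contrapT => xc'; apply: H; exists x, x, x.
by move=> [x [y [z [xc _ _ xc']]]]; apply: xc'; exact: H.
Qed.

Lemma borel_eq c c' : borel_prop (fun G : closed_subgroup => den c = @den G c').
Proof.
apply: borel_iff (borel_and (borel_subset c c') (borel_subset c' c)) => G.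
by rewrite eqEsubset.
Qed.

Lemma borel_prod_sub c c' c'' : borel_prop (fun G : closed_subgroup =>
  prod_sub (den c) (@den G c') (den c'')).
Proof.
have lw : locally_determined (fun x y _ => x * y)%g.
  by apply: locally_determinedM => x y z k; exists k.
apply: borel_iff (borel_not (borel_den3 c c' c' c'' lw)) => G; split=> [H|H].
  move=> _ [x xc [y yc <-]].
  by apply: contrapT => xc'; apply: H; exists x, y, y.
by move=> [x [y [z [xc yc _ xc']]]]; apply: xc'; apply: (H (x * y)%g); exists x => //; exists y.
Qed.

Lemma borel_coset_set c : borel_prop (fun G : closed_subgroup => coset_set (@den G c)).
Proof.
have lw : locally_determined (fun x y z => x * y^-1 * z)%g.
  apply: locally_determinedM; last by move=> x y z k; exists k.
  apply: locally_determinedM; first by move=> x y z k; exists k.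
  by apply: locally_determinedV => x y z k; exists k.
(* The code (0, [::]) denotes the empty set. *)
apply: borel_iff (borel_and (borel_not (borel_subset c (0%N, [::])))
  (borel_not (borel_den3 c c c c lw))) => G; split=> [[ne H]|[[x xc] H]].
  split.
    by apply: contrapT => /set0P/negP/negPn/eqP E; apply: ne; rewrite E.
  move=> x y z xc yc zc; apply: contrapT => wc; apply: H; exists x, y, z; split => //.
split; first by move=> /(_ x xc)[].
by move=> [y [z [t [yc zc tc nc]]]]; apply: nc; exact: H.
Qed.

Lemma borel_rpcoset c : borel_prop (fun G : closed_subgroup => rpcoset (@den G c)).
Proof.
apply: (@borel_iff _ closed_subgroup (fun G : closed_subgroup => coset_set (@den G c) /\
  forall k, exists S, den c `<=` @den G (k, S))) => [G|].
  by split=> /rpcoset_denP.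
apply: borel_and; first exact: borel_coset_set.
by apply: borel_all => k; apply: borel_ex => S; exact: borel_subset.
Qed.

(** * The graph attached to a closed subgroup *)

Lemma graph_nbhs_base (e : graph) (N : set graph) : nbhs e N ->
  exists k, [set e' : graph | forall x y, (x < k)%N -> (y < k)%N ->
    adj e' x y = adj e x y] `<=` N.
Proof.
pose B k := [set e' : graph | forall x y, (x < k)%N -> (y < k)%N ->
    adj e' x y = adj e x y].
pose F : set_system graph := filter_from [set: nat] B.
have FF : Filter F.
  apply: filter_from_filter; first by exists 0%N.
  move=> i j _ _; exists (maxn i j) => // e' e'e.
  by split=> x y xl yl; apply: e'e; rewrite leq_max ?xl ?yl ?orbT.
move=> [C [[D oD <-] De] DN].
have Fe : (fun e' : graph => \val e') @ F --> (\val e : {ptws nat * nat -> bool}).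
  apply/pointwise_cvgP => -[x y] A /= /nbhs_singleton Ae.
  exists (maxn x y).+1 => // e' e'e.
  by rewrite /= -[_ (x, y)]/(adj e' x y) e'e// ltnS ?leq_maxl ?leq_maxr.
have /Fe[k _ kD] : nbhs (\val e : {ptws nat * nat -> bool}) D.
  exact: open_nbhs_nbhs.
by exists k => e' /kD /DN.
Qed.

Lemma measurable_to_graph d (X : measurableType d) (f : X -> graph) :
  (forall x y, borel_prop (fun a => adj (f a) x y)) ->
  forall V, measurable V -> measurable (f @^-1` V).
Proof.
move=> mf V mV; rewrite -[X in measurable X]setTI.
apply: (@measurability _ _ X graph setT f (@open graph)) => // _ [U oU <-].
rewrite setTI.
pose P (i : nat * seq (nat * nat)) (a : X) :=
  (forall e : graph, (forall x y, (x < i.1)%N -> (y < i.1)%N ->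
     adj e x y = ((x, y) \in i.2)) -> U e) /\
  forall x y, ((x < i.1)%N /\ (y < i.1)%N) -> (adj (f a) x y <-> (x, y) \in i.2).
apply: (@borel_iff _ X (fun a => exists i, P i a)).
  move=> a; split=> [[[k s] [Us fs]]|Ufa].
    by apply: Us => x y xk yk; apply/idP/idP => /fs; apply.
  have [k kU] := graph_nbhs_base (open_nbhs_nbhs (conj oU Ufa)).
  pose s := [seq xy <- [seq (x, y) | x <- iota 0 k, y <- iota 0 k] |
    adj (f a) xy.1 xy.2].
  have sE x y : (x < k)%N -> (y < k)%N -> adj (f a) x y = ((x, y) \in s).
    by move=> xk yk; rewrite mem_filter allpairs_f ?andbT// mem_iota add0n.
  exists (k, s); split=> /= [e es|x y [xk yk]]; last by rewrite sE.
  by apply: kU => x y xk yk; rewrite es// sE.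
apply: borel_ex => -[k s]; apply: borel_and; first exact: borel_cst.
apply: borel_all => x; apply: borel_all => y.
case: (pselect ((x < k)%N /\ (y < k)%N)) => xy; last first.
  by apply: borel_iff (@borel_cst _ X True) => a; split=> // _ /xy.
case: (boolP ((x, y) \in s)) => xys.
  by apply: borel_iff (mf x y) => a; split=> [axy|/(_ xy)[_]]; last by apply.
by apply: borel_iff (borel_not (mf x y)) => a; split=> [axy|/(_ xy)[H _] /H].
Qed.

(** The last component makes each vertex have infinitely many names. *)
Definition name : Type :=
  (nat * coset_code * coset_code * coset_code * nat)%type.

Section coset_graph.
Variable G : closed_subgroup.

Definition vertex_named (i : option name) : vertex (set G) :=
  match i with
  | Some (0%N, c, _, _, _) => Elt (den c)
  | Some (i.+1, c1, c2, c3, _) => Path i (den c1) (den c2) (den c3)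
  | None => Junk
  end.

Definition coset_vertex (n : nat) : vertex (set G) :=
  let v := vertex_named (unpickle n) in
  if `[< is_vertex (@rpcosets G) (@prod_sub G) v >] then v else Junk.

Lemma infinite_names (f : nat -> name) (S : set nat) : injective f ->
  (forall j, S (pickle (f j))) -> infinite_set S.
Proof.
move=> f_inj fS fS_fin; apply: infinite_nat.
have -> : [set: nat] = (pickle \o f) @^-1` S by apply/seteqP; split=> // j _; exact: fS.
by apply: finite_preimage => // i j _ _ /= /(pcan_inj (@pickleK _))/f_inj.
Qed.

Lemma coset_vertex_naming : naming (@rpcosets G) (@prod_sub G) coset_vertex.
Proof.
split=> [n|v vG]; first by rewrite /coset_vertex; case: ifPn => // /asboolP.
have [f f_inj fv] : exists2 f : nat -> name, injective f &
    forall j, let v' := vertex_named (Some (f j)) in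
      v = v' \/ v = Junk /\ ~ is_vertex (@rpcosets G) (@prod_sub G) v'.
  case: v vG => [_|a /rpcoset_den[c <-]|i a b c [_ [/rpcoset_den[c1 <-]
      /rpcoset_den[c2 <-] /rpcoset_den[c3 <-] _]]].
  (* Paths stop at index 3, so the names with first component 5 are meaningless. *)
  - pose c : coset_code := (0%N, [::]).
    exists (fun j => (5, c, c, c, j)%N); first by move=> i j [].
    by move=> j; right; split=> //= -[].
  - by exists (fun j => (0%N, c, c, c, j)); [move=> i j []|left].
  - by exists (fun j => (i.+1, c1, c2, c3, j)); [move=> ? ? []|left].
apply: (infinite_names f_inj) => j; rewrite /mkset /coset_vertex pickleK.
case: (fv j) => [E|[-> nv]]; last by case: ifPn => // /asboolP.
by rewrite -E; case: ifPn => // /asboolP.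
Qed.

Lemma coset_graph_subproof :
  graph_set (fun p => `[< blowup coset_vertex p.1 p.2 >]).
Proof.
split=> [x y|x]; last by apply/asboolP => -[].
by apply/asboolP/asboolP => -[/nesym xy /edgeC].
Qed.

Definition coset_graph : graph := SigSub (mem_set coset_graph_subproof).

Lemma coset_graphE x y : adj coset_graph x y <-> blowup coset_vertex x y.
Proof. by split=> /asboolP. Qed.

End coset_graph.

Lemma borel_is_vertex i : borel_prop (fun G : closed_subgroup =>
  is_vertex (@rpcosets G) (@prod_sub G) (vertex_named G i)).
Proof.
case: i => [[[[[[|i] c1] c2] c3] _]|] /=; last exact: borel_cst.
  exact: borel_rpcoset.
apply: borel_and; first exact: borel_cst.
apply: (@borel_iff _ closed_subgroup (fun G : closed_subgroup =>
  rpcoset (@den G c1) /\ (rpcoset (@den G c2) /\ (rpcoset (@den G c3) /\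
  prod_sub (@den G c1) (den c2) (den c3))))).
  by move=> G; split=> [[? [? []]]|[]].
by do 3! [apply: borel_and; first exact: borel_rpcoset]; exact: borel_prod_sub.
Qed.

Lemma borel_arc i j : borel_prop (fun G : closed_subgroup =>
  vertex_arc (vertex_named G i) (vertex_named G j)).
Proof.
case: i j => [[[[[[|i] a] b] c] _]|] [[[[[[|j] a'] b'] c'] _]|] /=;
  try exact: borel_cst.
- exact: borel_eq.
- apply: (@borel_iff _ closed_subgroup (fun G : closed_subgroup =>
    (i = 1%N /\ den a' = @den G a) \/ ((i = 2%N /\ den a' = @den G b) \/
    (i = 3%N /\ den a' = @den G c)))).
    by move=> G; split=> [[|[]]|[]]; by [left|right;left|right;right|
      apply: Or31|apply: Or32|apply: Or33].
  by do 2? [apply: borel_or]; apply: borel_and; by [exact: borel_cst|exact: borel_eq].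
- apply: borel_and; first exact: borel_cst.
  apply: (@borel_iff _ closed_subgroup (fun G : closed_subgroup =>
    den a = @den G a' /\ (den b = @den G b' /\ den c = @den G c'))).
    by move=> G; split=> [[? []]|[]].
  by do 2? [apply: borel_and]; exact: borel_eq.
Qed.

Lemma borel_coset_graph x y :
  borel_prop (fun G : closed_subgroup => adj (coset_graph G) x y).
Proof.
pose V i (G : closed_subgroup) :=
  is_vertex (@rpcosets G) (@prod_sub G) (vertex_named G i).
apply: (@borel_iff _ closed_subgroup (fun G : closed_subgroup => x <> y /\
  (V (unpickle x) G /\ (V (unpickle y) G /\
   vertex_edge (vertex_named G (unpickle x)) (vertex_named G (unpickle y)))))).
  move=> G; rewrite coset_graphE /blowup /coset_vertex /V.
  split=> [[xy [/asboolT-> [/asboolT-> e]]]//|[xy]].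
  case: ifPn => [/asboolP vx|_ /edge_Junk//].
  case: ifPn => [/asboolP vy e|_]; first by [].
  by rewrite edgeC => /edge_Junk.
apply: borel_and; first exact: borel_cst.
do 2! [apply: borel_and; first exact: borel_is_vertex].
by apply: borel_or; exact: borel_arc.
Qed.

Lemma coset_graph_isom (G H : closed_subgroup) (A0 : set G) (B0 : set H) :
  rpcoset A0 -> rpcoset B0 ->
  group_isom G H <-> graph_isom (coset_graph G) (coset_graph H).
Proof.
move=> rA rB; have nG := coset_vertex_naming G; have nH := coset_vertex_naming H.
split=> [/topgroup_isom_coset_iso[t [t' tP]]|[p bp pe]].
  have [p bp pe] := ternary_iso_blowup nG nH tP.
  exists p => // x y; apply/idP/idP => /coset_graphE e; apply/coset_graphE.
    exact/pe.
  exact/pe.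
have [|t [t' tP]] := @blowup_ternary_iso _ _ _ _ _ _ A0 B0 _ _ p nG nH bp.
  by move=> x y; rewrite -!coset_graphE pe.
exact: (coset_iso_topgroup_isom rA rB tP).
Qed.

(** * Reducing group isomorphism to graph isomorphism *)

Lemma borel_reducible_graph_isom (C : set closed_subgroup) :
  (forall G : closed_subgroup, C G -> exists A : set G, rpcoset A) ->
  borel_reducible C group_isom [set: graph] graph_isom.
Proof.
move=> CA; exists coset_graph; split=> // [V mV|G H /CA[A rA] /CA[B rB]].
  exists (coset_graph @^-1` V) => //.
  exact: (measurable_to_graph borel_coset_graph mV).
exact: coset_graph_isom rA rB.
Qed.

(** * The compact group attached to a graph *)

Section extend.
Variable P : countType.

(** The permutation of nat induced by g on the codes of elements of P; numbers
    that are not codes are fixed. *)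
Definition extend (g : P -> P) (n : nat) : nat :=
  if pickle_inv n is Some p then pickle (g p) else n.

Lemma extend_pickle g p : extend g (pickle p) = pickle (g p).
Proof. by rewrite /extend pickleK_inv. Qed.

Lemma extend_ind (Q : nat -> Prop) :
  (forall p : P, Q (pickle p)) -> (forall n, pickle_inv (T := P) n = None -> Q n) ->
  forall n, Q n.
Proof.
move=> Qp Qn n; case E : (pickle_inv (T := P) n) => [p|]; last exact: Qn.
by have := pickle_invK (T := P) n; rewrite E /= => <-.
Qed.

Lemma extend_none g n : pickle_inv (T := P) n = None -> extend g n = n.
Proof. by rewrite /extend => ->. Qed.

Lemma extend_cancel g h : cancel g h -> cancel (extend g) (extend h).
Proof.
move=> gK; apply: extend_ind => [p|n nE]; first by rewrite !extend_pickle gK.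
by rewrite !extend_none// extend_none.
Qed.

Lemma extend_bij g : bijective g -> bijective (extend g).
Proof. by move=> [h gK hK]; exists (extend h); exact: extend_cancel. Qed.

End extend.

(** A block (u, None) stands for the vertex u and a block (u, Some v) for the
    ordered pair (u, v). Over each of them lies a copy of Z/15, which contains both
    Z/3 and Z/5. *)
Definition block : Type := (nat * option nat)%type.
Definition bpoint : Type := (block * 'Z_15)%type.

Definition block_sign (eps : nat -> bool) (b : block) : bool :=
  if b.2 is Some v then eps b.1 (+) eps v else eps b.1.

Section affine.
Local Open Scope ring_scope.
Implicit Types (eps : nat -> bool) (c : block -> 'Z_15).

Definition affine eps c (q : bpoint) : bpoint :=
  (q.1, (-1) ^+ block_sign eps q.1 * q.2 + c q.1).

Lemma block_sign_addb eps eps' b :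
  block_sign (fun u => eps u (+) eps' u) b = block_sign eps b (+) block_sign eps' b.
Proof. by case: b => u [v|] //=; rewrite /block_sign/= addbACA. Qed.

Lemma affineM eps c eps' c' q : affine eps c (affine eps' c' q) =
  affine (fun u => eps u (+) eps' u) (fun b => c b + (-1) ^+ block_sign eps b * c' b) q.
Proof.
by rewrite /affine/= block_sign_addb signr_addb mulrDr !mulrA -addrA (addrC (c _)).
Qed.

Definition affine_inv eps c := fun b => - ((-1) ^+ block_sign eps b * c b) : 'Z_15.

Lemma affine_id eps c q : (forall u, eps u = false) -> (forall b, c b = 0) ->
  affine eps c q = q.
Proof.
move=> e0 c0; case: q => -[u o] x; rewrite /affine c0 addr0 /block_sign/= !e0.
by case: o => [v|]; rewrite ?e0 mul1r.
Qed.

Lemma affineK eps c : cancel (affine eps c) (affine eps (affine_inv eps c)).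
Proof.
move=> q; rewrite affineM affine_id// => [u|b]; first by rewrite addbb.
by rewrite /affine_inv addNr.
Qed.

Lemma affineKV eps c : cancel (affine eps (affine_inv eps c)) (affine eps c).
Proof.
move=> q; rewrite affineM affine_id// => [u|b]; first by rewrite addbb.
by rewrite /affine_inv mulrN mulrA -signr_addb addbb mul1r subrr.
Qed.

Definition affine_perm eps c : Sinf :=
  mkSinf (extend_bij (Bijective (affineK eps c) (affineKV eps c))).

Lemma affine_permE eps c q : affine_perm eps c (pickle q) = pickle (affine eps c q).
Proof. exact: extend_pickle. Qed.

Lemma affine_perm_none eps c n : pickle_inv (T := bpoint) n = None ->
  affine_perm eps c n = n.
Proof. exact: extend_none. Qed.

Lemma affine_permM eps c eps' c' : (affine_perm eps c * affine_perm eps' c')%g =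
  affine_perm (fun u => eps u (+) eps' u) (fun b => c b + (-1) ^+ block_sign eps b * c' b).
Proof.
apply: SinfP; apply: (@extend_ind bpoint) => [q|n nE]; rewrite SinfME.
  by rewrite !affine_permE affineM.
by rewrite !affine_perm_none.
Qed.

Lemma affine_perm1 : affine_perm (fun=> false) (fun=> 0) = 1%g.
Proof.
apply: SinfP; apply: (@extend_ind bpoint) => [q|n nE].
  by rewrite affine_permE affine_id.
by rewrite affine_perm_none.
Qed.

Lemma affine_permV eps c : (affine_perm eps c)^-1%g = affine_perm eps (affine_inv eps c).
Proof.
apply: mulg1_eq; rewrite affine_permM -affine_perm1; apply: SinfP.
apply: (@extend_ind bpoint) => [q|n nE]; last by rewrite !affine_perm_none.
rewrite !affine_permE; congr pickle.
rewrite !affine_id// => [u|b]; first by rewrite addbb.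
by rewrite /affine_inv mulrN mulrA -signr_addb addbb mul1r subrr.
Qed.

Lemma affine_perm_ext eps c eps' c' : eps =1 eps' -> c =1 c' ->
  affine_perm eps c = affine_perm eps' c'.
Proof. by move=> /funext-> /funext->. Qed.

Lemma affine_perm_inj eps c eps' c' : affine_perm eps c = affine_perm eps' c' ->
  eps =1 eps' /\ c =1 c'.
Proof.
move=> E; have {}E q : affine eps c q = affine eps' c' q.
  by apply: (pcan_inj (@pickleK _)); rewrite -!affine_permE E.
have cE b : c b = c' b.
  by have := congr1 snd (E (b, 0)); rewrite /affine/= !mulr0 !add0r.
split=> // u; have := congr1 snd (E ((u, None), 1)).
rewrite /affine/= cE => /addIr; rewrite !mulr1 /block_sign/=.
by case: (eps u); case: (eps' u) => // /eqP.
Qed.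

(** The exponent of the translations allowed on a block: exponent 1 means that
    only the zero translation is allowed. *)
Definition torsion (A : graph) (b : block) : nat :=
  if b.2 is Some v then (if adj A b.1 v then 5 else 1)%N else 3%N.

Definition graph_perms (A : graph) : set Sinf :=
  [set p | exists eps c, (forall b, c b *+ torsion A b = 0) /\ p = affine_perm eps c].

Lemma graph_perms_group A : group_closed (mem (graph_perms A)).
Proof.
split.
  apply: mem_set; exists (fun=> false), (fun=> 0); rewrite affine_perm1.
  by split=> // b; rewrite mul0rn.
move=> _ _ /set_mem[e [c [c0 ->]]] /set_mem[e' [c' [c'0 ->]]]; apply: mem_set.
rewrite affine_permV affine_permM; eexists; eexists; split; last by [].
move=> b /=; rewrite mulrnDl c0 add0r -mulrnAr /affine_inv mulNrn -mulrnAr c'0.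
by rewrite mulr0 oppr0 mulr0.
Qed.

(** The admissible pairs (eps, c) form a product of finite sets of naturals. *)
Definition params (A : graph) (j : nat + block) : set nat :=
  match j with
  | inl _ => [set n | (n < 2)%N]
  | inr b => [set n | (n < 15)%N /\ (inZp n : 'Z_15) *+ torsion A b = 0]
  end.

Definition param_perm (xi : nat + block -> nat) : Sinf :=
  affine_perm (fun u => xi (inl u) == 1%N) (fun b => inZp (xi (inr b))).

Lemma graph_permsE A :
  graph_perms A = param_perm @` [set xi | forall j, params A j (xi j)].
Proof.
apply/seteqP; split=> [_ [e [c [c0 ->]]]|_ [xi xiA <-]].
  exists (fun j => match j with inl u => nat_of_bool (e u) | inr b => c b : nat end).
    case=> [u|b] /=; first by case: (e u).
    by split; [exact: ltn_ord|rewrite valZpK c0].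
  by apply: affine_perm_ext => [u|b]; [case: (e u)|rewrite valZpK].
exists (fun u => xi (inl u) == 1%N), (fun b => inZp (xi (inr b))).
by split=> // b; have [] := xiA (inr b).
Qed.

(** The image of a point over the block b depends on c b and on at most two
    values of eps. *)
Lemma param_perm_continuous :
  continuous (param_perm : prod_topology (fun _ : nat + block => nat) -> Sinf).
Proof.
move=> xi; have near j : \forall zeta \near xi, zeta j = xi j.
  have := @proj_continuous _ (fun _ : nat + block => nat) j xi [set xi j].
  by apply; exact: discrete_set1.
apply: (cvg_Sinf (nbhs_filter xi)); apply: (@extend_ind bpoint) => [[[u o] x]|n nE].
  have nv : \forall zeta \near xi, if o is Some v then zeta (inl v) = xi (inl v) else True.
    by case: o => [v|]; [exact: near|by apply: filterS (near (inl u))].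
  have H := [elaborate filterI (near (inl u)) (filterI (near (inr (u, o))) nv)].
  apply: filterS H => zeta [eu [eb ev]]; rewrite !affine_permE; congr pickle.
  rewrite /affine/= eb /block_sign/= eu; congr (_, _ * _ + _).
  by case: (o) ev => [v ->|].
by apply: nearW => zeta; rewrite /param_perm !affine_perm_none.
Qed.

Lemma Sinf_hausdorff : hausdorff_space Sinf.
Proof.
move=> p q pq; apply: SinfP => n.
by have [r [/= <- <-]] := pq _ _ (nbhs_Sinf_pt p n) (nbhs_Sinf_pt q n).
Qed.

Lemma graph_perms_compact A : compact (graph_perms A).
Proof.
rewrite graph_permsE.
apply: (@continuous_compact (prod_topology (fun _ : nat + block => nat)) Sinf).
  exact/continuous_subspaceT/param_perm_continuous.
apply: tychonoff => j; apply: finite_compact.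
apply: (@sub_finite_set _ _ `I_15); last exact: finite_II.
by case: j => [u|b] n /=; [move=> n2; apply: leq_trans n2 _|case].
Qed.

Lemma graph_perms_closed A : closed (graph_perms A).
Proof. apply: compact_closed; [exact: Sinf_hausdorff|exact: graph_perms_compact]. Qed.

Definition graph_group (A : graph) : closed_subgroup :=
  SigSub (mem_set (graph_perms_group A :
    subgroups (SigSub (mem_set (@graph_perms_closed A)) : closed_set Sinf))).

End affine.

Lemma compact_group_of (G : closed_subgroup) : compact (cset G) -> compact [set: G].
Proof.
move=> cG F PF _; pose F' := (fun g : G => \val g : Sinf) @ F.
have [|p [Gp clp]] := cG F' (fmap_proper_filter _ PF).
  by apply: (@filterS _ F _ [set: G]) => [g _|]; [exact: set_valP|exact: filterT].
exists (SigSub (mem_set Gp)); split=> // A B FA [_ [[C oC <-] /= Cp] CB].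
have [] := clp ((fun g : G => \val g : Sinf) @` A) C.
- by apply: (@filterS _ F _ A) => // g Ag; exists g.
- exact: open_nbhs_nbhs.
by move=> _ [[g Ag <-] Cg]; exists g; split=> //; exact: CB.
Qed.

Lemma graph_group_compact A : compact_groups (graph_group A).
Proof. exact/compact_group_of/graph_perms_compact. Qed.

Lemma nbhs_adj (e : graph) x y : nbhs e [set e' : graph | adj e' x y = adj e x y].
Proof.
have c : {for e, continuous
    (fun e' : graph => @proj (nat * nat)%type (fun=> bool) (x, y) (\val e'))}.
  apply: continuous_comp; last exact: proj_continuous.
  exact: (@initial_continuous graph {ptws nat * nat -> bool}).
by have := c [set adj e x y]; apply; exact: discrete_set1.
Qed.

Lemma nbhs_adj_lt (e : graph) k : nbhs e
  [set e' : graph | forall x y, (x < k)%N -> (y < k)%N -> adj e' x y = adj e x y].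
Proof.
have row m x : nbhs e [set e' : graph | forall y, (y < m)%N -> adj e' x y = adj e x y].
  elim: m => [|m IH]; first by apply: filterS filterT.
  apply: filterS (filterI IH (nbhs_adj e x m)) => e' [H1 H2] y.
  by rewrite ltnS leq_eqVlt => /orP[/eqP->//|/H1].
suff rows m : nbhs e
    [set e' : graph | forall x y, (x < m)%N -> (y < k)%N -> adj e' x y = adj e x y].
  exact: rows.
elim: m => [|m IH]; first by apply: filterS filterT.
apply: filterS (filterI IH (row k m)) => e' [H1 H2] x y.
by rewrite ltnS leq_eqVlt => /orP[/eqP->|xm yk]; [exact: H2|exact: H1].
Qed.

(** Whether a permutation moves the points below n in a prescribed way involves
    finitely many blocks. Making c zero on the other pairs yields a member of the
    group of each graph that agrees with A on these blocks. *)
Lemma graph_perms_hits_open (U : set Sinf) : open U ->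
  open [set A : graph | graph_perms A `&` U !=set0].
Proof.
move=> oU; rewrite openE => A [_ [[e [c [c0 ->]]] Up]].
have [n nU] := Sinf_nbhs_base (open_nbhs_nbhs (conj oU Up)).
pose bound i := if pickle_inv (T := bpoint) i is Some ((u, Some v), _)
  then maxn u.+1 v.+1 else 0%N.
pose k := \max_(i < n) bound i.
apply: filterS (nbhs_adj_lt A k) => B BA.
pose c' (b : block) := if b.2 is Some v then
  (if (b.1 < k)%N && (v < k)%N then c b else 0%R) else c b.
exists (affine_perm e c'); split.
  exists e, c'; split=> // -[u [v|]]; rewrite /c' /torsion /=; last exact: c0 (u, None).
  case: ifPn => [/andP[uk vk]|_]; last by rewrite mul0rn.
  by rewrite BA//; exact: c0 (u, Some v).
apply: nU => i ik.
have : (bound i <= k)%N by exact: (leq_bigmax (Ordinal ik)).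
rewrite /bound; case E : (pickle_inv (T := bpoint) i) => [[[u o] x]|]; last first.
  by rewrite !affine_perm_none.
have := pickle_invK (T := bpoint) i; rewrite E /= => <- bk.
rewrite !affine_permE; congr pickle; rewrite /affine/=; congr (_, _ + _)%R.
rewrite /c'/=; case: o {E} bk => [v|//].
by rewrite geq_max => /andP[-> ->].
Qed.

Lemma graph_group_measurable (V : set closed_subgroup) :
  measurable V -> measurable (graph_group @^-1` V).
Proof.
move=> [W mW <-]; rewrite setTI -comp_preimage.
rewrite -[X in measurable X]setTI.
apply: (@measurability _ _ graph (effros Sinf) setT _ [set hits U | U in @open Sinf]) => //.
move=> _ [_ [U oU <-] <-]; rewrite setTI.
by apply: sub_sigma_algebra; exact: graph_perms_hits_open.
Qed.

Lemma mkSinfE (f : nat -> nat) (bf : bijective f) n : mkSinf bf n = f n.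
Proof. by []. Qed.

Lemma conj_topgroup_isom (G H : closed_subgroup) (t : Sinf) :
  (forall p, cset G p -> cset H (t * p * t^-1)%g) ->
  (forall p, cset H p -> cset G (t^-1 * p * t)%g) -> topgroup_isom G H.
Proof.
move=> GH HG.
pose f (g : G) : H := SigSub (mem_set (GH _ (set_valP g))).
pose h (g : H) : G := SigSub (mem_set (HG _ (set_valP g))).
have conj_continuous (s r : Sinf) : continuous (fun p : Sinf => (s * p * r)%g).
  move=> p; apply: (@continuous_comp _ _ _ (fun p : Sinf => s * p)%g
    (fun p : Sinf => p * r)%g); first exact: mulg_continuousl.
  exact: mulg_continuousr.
exists f, h; split.
- by move=> g; apply/val_inj; rewrite /= !mulgA mulVg mul1g mulgVK.
- by move=> g; apply/val_inj; rewrite /= !mulgA mulgV mul1g mulgK.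
- by move=> x y; apply/val_inj; rewrite /= !mulgA mulgVK.
- apply: group_of_continuous => g.
  apply: (@continuous_comp _ _ _ (fun x : G => \val x : Sinf)
    (fun p : Sinf => t * p * t^-1)%g); last exact: conj_continuous.
  exact: group_of_val_continuous.
- apply: group_of_continuous => g.
  apply: (@continuous_comp _ _ _ (fun x : H => \val x : Sinf)
    (fun p : Sinf => t^-1 * p * t)%g); last exact: conj_continuous.
  exact: group_of_val_continuous.
Qed.

Definition relabel (p : nat -> nat) (q : bpoint) : bpoint :=
  ((p q.1.1, omap p q.1.2), q.2).

Lemma relabelK p q : cancel p q -> cancel (relabel p) (relabel q).
Proof. by move=> pK [[u [v|]] x]; rewrite /relabel/= !pK. Qed.

(** Conjugation by a relabelling of the blocks turns (eps, c) into
    (eps o p^-1, c o p^-1). *)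
Lemma graph_perms_relabel (A B : graph) p q (s t : Sinf) :
  cancel p q -> cancel q p ->
  (forall x y, adj A x y = adj B (p x) (p y)) ->
  s =1 extend (relabel p) -> t =1 extend (relabel q) ->
  forall g, graph_perms A g -> graph_perms B (s * g * t)%g.
Proof.
move=> pK qK AB sE tE _ [e [c [c0 ->]]].
exists (e \o q), (fun b => c (q b.1, omap q b.2)); split.
  move=> [u o]; rewrite -[RHS](c0 (q u, omap q o)) /torsion/=.
  by case: o => [v|//] /=; rewrite AB !qK.
apply: SinfP; apply: (@extend_ind bpoint) => [[[u o] x]|n nE]; rewrite !SinfME.
  rewrite tE extend_pickle !affine_permE sE extend_pickle; congr pickle.
  rewrite /relabel/affine/= qK; congr (_, _, _ * _ + _)%R; last by case: o => [v|].
  by case: o => [v|] //=; rewrite qK.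
by rewrite tE extend_none// !affine_perm_none// sE extend_none.
Qed.

Lemma graph_isom_topgroup_isom (A B : graph) :
  graph_isom A B -> topgroup_isom (graph_group A) (graph_group B).
Proof.
move=> [p [q pK qK] AB].
pose t := mkSinf (extend_bij (Bijective (relabelK pK) (relabelK qK))).
have tV : ((t^-1)%g : Sinf) =1 extend (relabel q).
  move=> n; apply: (can_inj (SinfVK t)); rewrite SinfKV.
  by rewrite mkSinfE (extend_cancel (relabelK qK)).
have tE : t =1 extend (relabel p) by move=> n; rewrite mkSinfE.
have BA x y : adj B x y = adj A (q x) (q y) by rewrite AB !qK.
apply: (@conj_topgroup_isom _ _ t) => g gA.
  exact: (@graph_perms_relabel A B p q t t^-1%g pK qK AB tE tV g gA).
exact: (@graph_perms_relabel B A q p t^-1%g t qK pK BA tV tE g gA).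
Qed.

(** * Recovering the graph from the abstract group *)

Section recover_defs.
Variable G : groupType.
Implicit Types g t r : G.

Definition centralizes g t : Prop := (g * t * g^-1 = t)%g.

Definition vertex_elt t : Prop :=
  [/\ t <> 1, t ^+ 3 = 1 & forall g, g * t * g^-1 = t \/ g * t * g^-1 = t^-1]%g.

Definition adjacent_elts t t' : Prop := exists r,
  [/\ r <> 1, r ^+ 5 = 1 &
      forall g, centralizes g r <-> (centralizes g t <-> centralizes g t')]%g.

End recover_defs.

Section recover_transfer.
Variables (G H : groupType) (f : G -> H) (h : H -> G).
Hypotheses (fK : cancel f h) (hK : cancel h f).
Hypothesis fM : {morph f : x y / (x * y)%g}.

Lemma morph_one : f 1%g = 1%g.
Proof. by apply: (mulgI (f 1%g)); rewrite -fM !mulg1. Qed.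

Lemma morph_inv x : f x^-1%g = (f x)^-1%g.
Proof. by apply/esym/mulg1_eq; rewrite -fM mulgV morph_one. Qed.

Lemma morph_exp x n : f (x ^+ n)%g = (f x ^+ n)%g.
Proof. by elim: n => [|n IH]; rewrite ?morph_one// !expgS fM IH. Qed.

Lemma morph_centralizes g t : centralizes (f g) (f t) <-> centralizes g t.
Proof.
by rewrite /centralizes -morph_inv -!fM; split=> [/(can_inj fK)//|->].
Qed.

Lemma morph_vertex_elt t : vertex_elt t -> vertex_elt (f t).
Proof.
move=> [t1 t3 tg]; split.
- by rewrite -morph_one => /(can_inj fK).
- by rewrite -morph_exp t3 morph_one.
move=> g; rewrite -(hK g) -!morph_inv -!fM.
by case: (tg (h g)) => ->; [left|right].
Qed.

Lemma morph_adjacent_elts t t' : adjacent_elts t t' -> adjacent_elts (f t) (f t').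
Proof.
move=> [r [r1 r5 rg]]; exists (f r); split.
- by rewrite -morph_one => /(can_inj fK).
- by rewrite -morph_exp r5 morph_one.
by move=> g; rewrite -(hK g) !morph_centralizes.
Qed.

End recover_transfer.

Section recover.
Local Open Scope ring_scope.

Lemma Z15_mulrn15 (x : 'Z_15) : x *+ 15 = 0.
Proof. by rewrite -mulr_natr (_ : 15%:R = 0) ?mulr0//; exact/eqP. Qed.

Lemma Z15_opp (x : 'Z_15) : - x = x -> x = 0.
Proof.
move=> xx; have x2 : x *+ 2 = 0 by rewrite mulr2n -{1}xx addNr.
by have := Z15_mulrn15 x; rewrite (mulrSr _ 14) (mulrnA x 2 7) x2 mul0rn add0r.
Qed.

Lemma Z15_coprime (x : 'Z_15) : x *+ 3 = 0 -> x *+ 5 = 0 -> x = 0.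
Proof.
move=> x3 x5; have : x *+ (3 * 2) = x *+ 5 + x by rewrite -mulrSr.
by rewrite mulrnA x3 mul0rn x5 add0r.
Qed.

Variable A : graph.
Let G := graph_group A.

Lemma graph_group_coords : exists ec : G -> (nat -> bool) * (block -> 'Z_15),
  forall g, (forall b, (ec g).2 b *+ torsion A b = 0) /\
    \val g = affine_perm (ec g).1 (ec g).2 :> Sinf.
Proof.
suff /choice[ec ecP] : forall g : G, exists ec : (nat -> bool) * (block -> 'Z_15),
    (forall b, ec.2 b *+ torsion A b = 0) /\
    \val g = affine_perm ec.1 ec.2 :> Sinf by exists ec.
by move=> g; have [e [c [c0 gE]]] : graph_perms A (\val g) := set_valP g; exists (e, c).
Qed.

Definition coords := sval (cid graph_group_coords).
Definition eps (g : G) : nat -> bool := (coords g).1.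
Definition coef (g : G) : block -> 'Z_15 := (coords g).2.

Lemma coef_torsion g b : coef g b *+ torsion A b = 0.
Proof. by have [H _] := svalP (cid graph_group_coords) g; exact: H. Qed.

Lemma coordsE g : \val g = affine_perm (eps g) (coef g) :> Sinf.
Proof. by have [_ H] := svalP (cid graph_group_coords) g; exact: H. Qed.

Lemma coordsP (g : G) e c : \val g = affine_perm e c :> Sinf ->
  eps g =1 e /\ coef g =1 c.
Proof. by rewrite coordsE => /affine_perm_inj. Qed.

Lemma coords_surj e c : (forall b, c b *+ torsion A b = 0) ->
  exists g : G, eps g =1 e /\ coef g =1 c.
Proof.
move=> c0; have gP : graph_perms A (affine_perm e c) by exists e, c.
by exists (SigSub (mem_set gP)); exact: coordsP.
Qed.

Lemma coords_ext (g h : G) : eps g =1 eps h -> coef g =1 coef h -> g = h.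
Proof. by move=> e c; apply/val_inj; rewrite !coordsE; exact: affine_perm_ext. Qed.

Lemma coordsM (g h : G) : eps (g * h)%g =1 (fun u => eps g u (+) eps h u) /\
  coef (g * h)%g =1 (fun b => coef g b + (-1) ^+ block_sign (eps g) b * coef h b).
Proof. by apply: coordsP; rewrite -affine_permM -!coordsE. Qed.

Lemma coords1 : eps 1%g =1 (fun=> false) /\ coef 1%g =1 (fun=> 0).
Proof. by apply: coordsP; rewrite affine_perm1. Qed.

Lemma coordsV (g : G) : eps g^-1%g =1 eps g /\
  coef g^-1%g =1 (fun b => - ((-1) ^+ block_sign (eps g) b * coef g b)).
Proof. by apply: coordsP; rewrite -[RHS]affine_permV -coordsE. Qed.

Lemma block_sign0 (e : nat -> bool) b : (forall u, e u = false) -> block_sign e b = false.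
Proof. by case: b => u [v|] e0; rewrite /block_sign/= !e0. Qed.

Lemma eq_block_sign (e e' : nat -> bool) b : e =1 e' -> block_sign e b = block_sign e' b.
Proof. by move=> /funext ->. Qed.

(** An element with eps = 0 is a translation, and conjugation only changes
    the signs of its components. *)
Lemma coords_conj (g t : G) : (forall u, eps t u = false) ->
  (forall u, eps (g * t * g^-1)%g u = false) /\
  forall b, coef (g * t * g^-1)%g b = (-1) ^+ block_sign (eps g) b * coef t b.
Proof.
move=> t0; have [e1 c1] := coordsM (g * t)%g g^-1%g.
have [e2 c2] := coordsM g t; have [e3 c3] := coordsV g.
have e2' : eps (g * t)%g =1 eps g by move=> u; rewrite e2 t0 addbF.
split=> [u|b]; first by rewrite e1 e2' e3 addbb.
rewrite c1 c2 c3 (eq_block_sign b e2') mulrN mulrA -signr_addb addbb mul1r.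
by rewrite addrAC subrr add0r.
Qed.

Lemma coords_exp (t : G) n : (forall u, eps t u = false) ->
  (forall u, eps (t ^+ n)%g u = false) /\ forall b, coef (t ^+ n)%g b = coef t b *+ n.
Proof.
move=> t0; elim: n => [|n [IHe IHc]]; first by have [? ?] := coords1.
rewrite expgS; have [e c] := coordsM t (t ^+ n)%g; split=> [u|b].
  by rewrite e t0 IHe.
by rewrite c IHc (block_sign0 _ t0) mul1r -mulrS.
Qed.

Lemma eps_exp_odd (t : G) n : odd n -> (t ^+ n)%g = 1%g -> forall u, eps t u = false.
Proof.
move=> on tn u; have : eps (t ^+ n)%g u = odd n && eps t u.
  elim: n {on tn} => [|n IH]; first by rewrite coords1.1.
  rewrite expgS (coordsM _ _).1 IH /=; by case: (odd n); case: (eps t u).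
by rewrite tn coords1.1 on /= => <-.
Qed.

Lemma order3_coords (t : G) : (t ^+ 3)%g = 1%g ->
  (forall u, eps t u = false) /\ forall u v, coef t (u, Some v) = 0.
Proof.
move=> t3; have t0 := eps_exp_odd (n := 3) isT t3; split=> // u v.
have x3 : coef t (u, Some v) *+ 3 = 0.
  by rewrite -(coords_exp 3 t0).2 t3 coords1.2.
have := coef_torsion t (u, Some v); rewrite /torsion/=; case: ifP => // _.
exact: Z15_coprime.
Qed.

Lemma order5_coords (t : G) : (t ^+ 5)%g = 1%g ->
  [/\ forall u, eps t u = false, forall u, coef t (u, None) = 0 &
      forall u v, coef t (u, Some v) <> 0 -> adj A u v].
Proof.
move=> t5; have t0 := eps_exp_odd (n := 5) isT t5; split=> // [u|u v].
  have x5 : coef t (u, None) *+ 5 = 0.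
    by rewrite -(coords_exp 5 t0).2 t5 coords1.2.
  exact: Z15_coprime (coef_torsion t (u, None)) x5.
by have := coef_torsion t (u, Some v); rewrite /torsion/=; case: ifP.
Qed.

Lemma nontrivial_coef (t : G) : t <> 1%g -> (forall u, eps t u = false) ->
  exists b, coef t b <> 0.
Proof.
move=> t1 t0; apply: contrapT => c0; apply: t1; apply: coords_ext => [u|b].
  by rewrite t0 coords1.1.
by rewrite coords1.2; apply: contrapT => cb; apply: c0; exists b.
Qed.

Lemma centralizesP (g t : G) : (forall u, eps t u = false) ->
  centralizes g t <-> forall b, coef t b <> 0 -> block_sign (eps g) b = false.
Proof.
move=> t0; have [e c] := coords_conj g t0; split=> [gt b|gt].
  by have := c b; rewrite gt; case: (block_sign _ _) => //; rewrite mulN1r => /esym/Z15_opp.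
apply: coords_ext => [u|b]; first by rewrite e t0.
rewrite c; have [->|/eqP cb] := eqVneq (coef t b) 0; first by rewrite mulr0.
by rewrite gt// mul1r.
Qed.

(** The vertex of t is read off from the centralizer of t. *)
Definition sits_at (t : G) (u : nat) : Prop :=
  forall g, centralizes g t <-> eps g u = false.

Lemma eps_surj e : exists g : G, eps g =1 e /\ coef g =1 (fun=> 0).
Proof. by apply: coords_surj => b; rewrite mul0rn. Qed.

(** If t had nonzero components at two vertices u and v, the element with eps = 1
    at u only would negate the first and fix the second, and so would neither
    centralize nor invert t. *)
Lemma vertex_elt_sits (t : G) : vertex_elt t -> exists u, sits_at t u.
Proof.
move=> [t1 t3 tg]; have [t0 tpair] := order3_coords t3.
have [[u [v|]]] := nontrivial_coef t1 t0; first by rewrite tpair.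
move=> cu; exists u => g; rewrite centralizesP//; split=> [/(_ _ cu)//|gu].
move=> [v [w|]]; first by rewrite tpair.
rewrite /block_sign/=; have [->//|vu] := eqVneq v u; case.
have [s [se sc]] := eps_surj (pred1 u).
have [e c] := coords_conj s t0; have cE b := c b.
case: (tg s) => st; rewrite st in cE.
  exfalso; apply: cu; apply: Z15_opp.
  by have := cE (u, None); rewrite /block_sign/= se/= eqxx mulN1r.
apply: Z15_opp; have := cE (v, None).
rewrite (coordsV t).2 (block_sign0 _ t0) mul1r => ->.
by rewrite /block_sign/= se/= (negbTE vu) mul1r.
Qed.

Lemma vertex_elt_exists u : exists2 t : G, vertex_elt t & sits_at t u.
Proof.
(* In Z/15, 5 has order 3. *)
pose c (b : block) : 'Z_15 := if b == (u, None) then 5%:R else 0.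
have [b|t [te tc]] := @coords_surj (fun=> false) c.
  rewrite /c; case: eqP => [->|_]; last by rewrite mul0rn.
  by rewrite /torsion/=; exact/eqP.
have cu : coef t (u, None) <> 0 by rewrite tc /c eqxx => /eqP.
have c0 b : b <> (u, None) -> coef t b = 0 by rewrite tc /c; case: eqP.
exists t; first split.
- by move=> t1; apply: cu; rewrite t1 coords1.2.
- have [e3 c3] := coords_exp 3 te; apply: coords_ext => [v|b].
    by rewrite e3 coords1.1.
  rewrite c3 coords1.2; have [->|/eqP/c0->] := eqVneq b (u, None).
    by rewrite (coef_torsion t (u, None)).
  by rewrite mul0rn.
- move=> g; have [e4 c4] := coords_conj g te.
  case E : (eps g u); [right|left]; apply: coords_ext => [v|b].
  + by rewrite e4 (coordsV t).1 te.
  + rewrite c4 (coordsV t).2 (block_sign0 _ te) mul1r.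
    have [->|/eqP/c0->] := eqVneq b (u, None); last by rewrite mulr0 oppr0.
    by rewrite /block_sign/= E mulN1r.
  + by rewrite e4 te.
  + rewrite c4; have [->|/eqP/c0->] := eqVneq b (u, None); last by rewrite mulr0.
    by rewrite /block_sign/= E mul1r.
move=> g; rewrite centralizesP//; split=> [/(_ _ cu)//|gu b cb].
by have [->//|/eqP/c0/cb] := eqVneq b (u, None).
Qed.

Lemma sits_at_inj (t t' : G) u v : sits_at t u -> sits_at t' v ->
  (forall g, centralizes g t <-> centralizes g t') -> u = v.
Proof.
move=> tu tv tt'; have [s [se _]] := eps_surj (pred1 u).
have := tt' s; rewrite tu tv !se /= eqxx; case: eqP => // _ [_ H].
by have := H erefl.
Qed.

(** A generator of the component Z/5 at (u, v) is centralized exactly when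
    eps u = eps v. Conversely a nonzero component of r at (x, y) is fixed only if
    eps x = eps y, so eps u = eps v implies eps x = eps y; taking for eps the
    indicators of x and of y gives {u, v} = {x, y}. *)
Lemma adjacent_eltsP (t t' : G) u v : sits_at t u -> sits_at t' v ->
  adjacent_elts t t' <-> adj A u v.
Proof.
move=> tu tv; split=> [[r [r1 r5 rg]]|uv].
  have [r0 rvert rpair] := order5_coords r5.
  have [[x [y|]]] := nontrivial_coef r1 r0; last by rewrite rvert.
  move=> cxy; have Axy := rpair _ _ cxy.
  have [symA irrA] := set_mem (valP A).
  have xy : x <> y by move=> E; move: Axy; rewrite E /adj irrA.
  have uvxy (e : nat -> bool) : e u = e v -> e x = e y.
    move=> euv; have [g [ge _]] := eps_surj e.
    have /(centralizesP g r0)/(_ _ cxy) : centralizes g r.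
      by apply/rg; rewrite tu tv !ge euv.
    by rewrite /block_sign/= !ge; case: (e x); case: (e y).
  have xyF : (x == y) = false by exact/eqP.
  have nx : (u == x) <> (v == x).
    by move=> /(uvxy (pred1 x)); rewrite /= eqxx eq_sym xyF.
  have ny : (u == y) <> (v == y).
    by move=> /(uvxy (pred1 y)); rewrite /= eqxx xyF.
  move: nx ny; have [->|_] := eqVneq u x; have [->|_] := eqVneq v x => // _; rewrite xyF.
    by have [->|] := eqVneq v y.
  by have [->|//] := eqVneq u y; rewrite /adj symA.
(* In Z/15, 3 has order 5. *)
pose c (b : block) : 'Z_15 := if b == (u, Some v) then 3%:R else 0.
have [b|r [re rc]] := @coords_surj (fun=> false) c.
  rewrite /c; case: eqP => [->|_]; last by rewrite mul0rn.
  by rewrite /torsion/= uv; exact/eqP.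
have cuv : coef r (u, Some v) <> 0 by rewrite rc /c eqxx => /eqP.
have c0 b : b <> (u, Some v) -> coef r b = 0 by rewrite rc /c; case: eqP.
exists r; split.
- by move=> r1; apply: cuv; rewrite r1 coords1.2.
- have [e5 c5] := coords_exp 5 re; apply: coords_ext => [w|b].
    by rewrite e5 coords1.1.
  rewrite c5 coords1.2; have [->|/eqP/c0->] := eqVneq b (u, Some v).
    by have := coef_torsion r (u, Some v); rewrite /torsion/= uv.
  by rewrite mul0rn.
move=> g; rewrite centralizesP// tu tv; split=> [/(_ _ cuv)|guv b cb].
  by rewrite /block_sign/=; case: (eps g u); case: (eps g v).
have -> : b = (u, Some v) by apply: contrapT => /c0/cb.
rewrite /block_sign/=; move: guv.
by case: (eps g u); case: (eps g v) => // -[H1 H2]; [have := H2 erefl|have := H1 erefl].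
Qed.

End recover.

Lemma topgroup_isom_graph_isom (A B : graph) :
  topgroup_isom (graph_group A) (graph_group B) -> graph_isom A B.
Proof.
move=> [f [h [fK hK fM _ _]]].
have hM : {morph h : x y / (x * y)%g}.
  by move=> x y; rewrite -{1}(hK x) -{1}(hK y) -fM fK.
have /choice[p pP] : forall u, exists v, exists2 t : graph_group A,
    vertex_elt t /\ sits_at t u & sits_at (f t) v.
  move=> u; have [t tV tu] := vertex_elt_exists A u.
  by have [v tv] := vertex_elt_sits (morph_vertex_elt fK hK fM tV); exists v, t.
have /choice[q qP] : forall v, exists u, exists2 t : graph_group B,
    vertex_elt t /\ sits_at t v & sits_at (h t) u.
  move=> v; have [t tV tv] := vertex_elt_exists B v.
  by have [u tu] := vertex_elt_sits (morph_vertex_elt hK fK hM tV); exists u, t.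
exists p.
  exists q => [u|v].
    have [t [tV tu] ftu] := pP u; have [t' [tV' tu'] ht'] := qP (p u).
    apply: (sits_at_inj ht' tu) => g.
    rewrite -(morph_centralizes fK fM) hK -[centralizes g t](morph_centralizes fK fM).
    by rewrite tu' ftu.
  have [t [tV tu] ftu] := qP v; have [t' [tV' tu'] ht'] := pP (q v).
  apply: (sits_at_inj ht' tu) => g.
  rewrite -(morph_centralizes hK hM) fK -[centralizes g t](morph_centralizes hK hM).
  by rewrite tu' ftu.
move=> u v; have [t [_ tu] ftu] := pP u; have [t' [_ tv] ftv] := pP v.
apply/idP/idP => [/(adjacent_eltsP tu tv)|/(adjacent_eltsP ftu ftv)] H.
  by apply/(adjacent_eltsP ftu ftv); exact: (morph_adjacent_elts fK hK fM).
apply/(adjacent_eltsP tu tv).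
by have := morph_adjacent_elts hK fK hM H; rewrite !fK.
Qed.

Lemma graph_isom_borel_reducible (C : set closed_subgroup) :
  compact_groups `<=` C ->
  borel_reducible [set: graph] graph_isom C group_isom.
Proof.
move=> cC; exists graph_group; split.
- by move=> A _; apply: cC; exact: graph_group_compact.
- move=> V mV; exists (graph_group @^-1` V) => //.
  exact: graph_group_measurable.
by move=> A B _ _; split; [exact: graph_isom_topgroup_isom|exact: topgroup_isom_graph_isom].
Qed.

Theorem mainTheorem1 :
  [/\ borel_bireducible compact_groups group_isom [set: graph] graph_isom,
      borel_bireducible locally_compact_groups group_isom
        [set: graph] graph_isom,
      borel_bireducible roelcke_precompact_groups group_isom
        [set: graph] graph_isom &
      borel_reducible oligomorphic_groups group_isom [set: graph] graph_isom].
Proof.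
have rp (G : closed_subgroup) : roelcke_precompact G -> exists A : set G, rpcoset A.
  by move=> /roelcke_precompactP rG; exists setT; exact: rcovered_rpcosetT.
split; [split|split|split|].
- by apply: borel_reducible_graph_isom => G /compact_roelcke_precompact/rp.
- exact: graph_isom_borel_reducible.
- by apply: borel_reducible_graph_isom => G /locally_compact_rpcoset.
- apply: graph_isom_borel_reducible => G; exact: compact_locally_compact.
- by apply: borel_reducible_graph_isom => G /rp.
- apply: graph_isom_borel_reducible => G; exact: compact_roelcke_precompact.
by apply: borel_reducible_graph_isom => G /oligomorphic_roelcke_precompact/rp.
Qed.
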